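(* For every integer $d\ge 1$ there exist constants $B, C_1, C_2>0$, depending only on $d$, such that for all $N\in\mathbb{N}$ large enough and for all $t\ge 0$, $$\bigl(1+C_1(t\wedge 1)\bigr)\,\mathcal{E}\Bigl(\frac{\pi_t(0,\cdot)}{\pi}\Bigr)\;\le\; \mathbb{E}\Bigl[\mathcal{E}\Bigl(\frac{\eta_t(0,\cdot)}{\pi}\Bigr)\Bigr]\;\le\; C_2\exp\Bigl(\frac{Bt}{N^{d+2}}\Bigr)\,\mathcal{E}\Bigl(\frac{\pi_t(0,\cdot)}{\pi}\Bigr),$$ where $\eta_t(0,\cdot)$ is the averaging process on the discrete torus $\mathbb{T}^d_N$ started from the unit mass at $0$, $\pi_t(0,\cdot)$ is the law at time $t$ of the random walk $\mathrm{RW}(\mathbb{T}^d_N)$ started from $0$, $\pi$ is the uniform distribution on $\mathbb{T}^d_N$, and $\mathcal{E}$ is the Dirichlet form of $\mathrm{RW}(\mathbb{T}^d_N)$.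
   Context: $\mathbb{T}^d_N=(\mathbb{Z}/N\mathbb{Z})^d$ is the discrete torus with graph distance $|x-y|$ (nearest neighbors are pairs with $|x-y|=1$); $\pi\equiv N^{-d}$ is the uniform distribution on it; $\mathcal{P}(\mathbb{T}^d_N)$ is the set of probability mass functions on $\mathbb{T}^d_N$. Averaging process: the Markov jump process on $\mathcal{P}(\mathbb{T}^d_N)$ with generator $\mathcal{L}f(\eta)=\frac12\sum_{x\in\mathbb{T}^d_N}\sum_{y:|x-y|=1}\bigl(f(\eta^{xy})-f(\eta)\bigr)$ for continuous $f$, where $\eta^{xy}(z)=\frac12(\eta(x)+\eta(y))$ if $z\in\{x,y\}$ and $\eta^{xy}(z)=\eta(z)$ otherwise. That is, each unordered nearest-neighbor pair has an independent rate-1 Poisson clock, and when it rings the two masses are replaced by their average. $\mathbb{P},\mathbb{E}$ are the law and expectation of the random updates. $\eta_t(0,\cdot)$ denotes the process at time $t$ started from the Dirac mass $\mathbf{1}_0$ at $0\in\mathbb{T}^d_N$. $\mathrm{RW}(\mathbb{T}^d_N)$: the continuous-time random walk with generator $L^{\rm RW}\psi(x)=\frac12\sum_{y:|x-y|=1}(\psi(y)-\psi(x))$; $\pi_t(0,x)=\mathbf{P}^{\rm RW}_0(X_t=x)$ is its law at time $t$ started from $0$. Dirichlet form: $\mathcal{E}(\psi)=\frac{1}{4N^d}\sum_{x\in\mathbb{T}^d_N}\sum_{y:|x-y|=1}(\psi(x)-\psi(y))^2$ for $\psi\in\mathbb{R}^{\mathbb{T}^d_N}$. Notation: $a\wedge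 b=\min\{a,b\}$. *)

(* Defs.v *)
From HB Require Import structures.
From mathcomp Require Import all_boot all_order all_algebra.
From mathcomp Require Import all_classical all_reals all_analysis.
From mathcomp Require Import ring.
Set Implicit Arguments.
Unset Strict Implicit.
Unset Printing Implicit Defensive.
Import Order.TTheory GRing.Theory Num.Theory.
Import numFieldNormedType.Exports.
Local Open Scope classical_set_scope.
Local Open Scope ring_scope.

(* Markov jump processes with a prescribed generator. The state space E is
   meant to be compact, so that every continuous function on E is bounded. *)
Section markov.
Context {R : realType} {E : topologicalType}.
Implicit Types (S : R -> (E -> R) -> E -> R) (L : (E -> R) -> E -> R).

(* S is only relevant at nonnegative times and on continuous functions. *)
Record feller_semigroup S : Prop := FellerSemigroup {
  feller_continuous : forall (t : R) (f : E -> R),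
    0 <= t -> continuous f -> continuous (S t f);
  feller_linear : forall (t a : R) (f g : E -> R),
    0 <= t -> continuous f -> continuous g ->
    S t (fun x => a * f x + g x) = (fun x => a * S t f x + S t g x);
  feller_one : forall t : R, 0 <= t -> S t (fun=> 1) = (fun=> 1);
  feller_ge0 : forall (t : R) (f : E -> R), 0 <= t -> continuous f ->
    (forall x, 0 <= f x) -> forall x, 0 <= S t f x;
  feller_id : forall f : E -> R, continuous f -> S 0 f = f;
  feller_add : forall (s t : R) (f : E -> R), 0 <= s -> 0 <= t ->
    continuous f -> S (s + t) f = S s (S t f);
  feller_cvg : forall f : E -> R, continuous f -> forall e : R, 0 < e ->
    \forall h \near (0 : R)^'+, forall x, `|S h f x - f x| <= e }.

(* The generator is defined on every continuous function, and the limit is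
   uniform over the state space. *)
Definition has_generator S L : Prop :=
  forall f : E -> R, continuous f -> forall e : R, 0 < e ->
    \forall h \near (0 : R)^'+, forall x, `|(S h f x - f x) / h - L f x| <= e.

Definition past {T : Type} (X : R -> T -> E) (s : R) : set (set T) :=
  <<s [set A | exists (u : R) (U : set E),
         [/\ 0 <= u <= s, open U & A = X u @^-1` U]] >>.

Definition step_path (p : R -> E) : Prop :=
  (forall t : R, 0 <= t -> \forall s \near t^'+, p s = p t) /\
  (forall t : R, 0 < t -> exists v, \forall s \near t^'-, p s = v).

Record markov_jump_process d (T : measurableType d) (P : probability T R)
    L (x0 : E) (X : R -> T -> E) : Prop := MarkovJumpProcess {
  process_measurable : forall (t : R) (U : set E), 0 <= t -> open U ->
    measurable (X t @^-1` U);
  process_start : {ae P, forall w, X 0 w = x0};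
  process_step_path : {ae P, forall w, step_path (X ^~ w)};
  (* E[f(X_(s+t)) | X_u, u <= s] = (S t f)(X_s) *)
  process_markov : exists S, [/\ feller_semigroup S, has_generator S L &
    forall (s t : R) (f : E -> R) (A : set T),
      0 <= s -> 0 <= t -> continuous f -> past X s A ->
      (\int[P]_(w in A) (f (X (s + t) w))%:E =
       \int[P]_(w in A) (S t f (X s w))%:E)%E] }.

End markov.

(* (Z/NZ)^d; since 'Z_0 = 'Z_1 = 'Z_2, only N >= 2 is meaningful. *)
Definition torus (d N : nat) := {ffun 'I_d -> 'Z_N}.

Section torus.
Variables (R : realType) (d N : nat).
Local Notation T := (torus d N).
Implicit Types (x y z : T).

(* The graph distance of Z/NZ between a and b is the minimum of k and N - k,
   with k the representative of a - b in {0, ..., N - 1}. *)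
Definition torus_dist x y : nat :=
  (\sum_(i < d) minn (x i - y i)%R (N - (x i - y i)%R))%N.

Definition uniform_mass : T -> R := fun=> (N%:R ^+ d)^-1.

Definition dirichlet (psi : T -> R) : R :=
  (4 * N%:R ^+ d)^-1 *
  \sum_(x : T) \sum_(y : T | torus_dist x y == 1%N) (psi x - psi y) ^+ 2.

Definition rw_generator (psi : discrete_topology T -> R)
    (x : discrete_topology T) : R :=
  2^-1 * \sum_(y : T | torus_dist x y == 1%N) (psi y - psi x).

Definition torus_pmf_set : set {ptws T -> R} :=
  [set m | (forall x, 0 <= m x) /\ \sum_(x : T) m x = 1].

(* The subspace topology of the product topology on R^T. *)
Definition torus_pmf := set_type torus_pmf_set.

Definition mass (p : torus_pmf) : T -> R := set_val p.

Definition dirac_mass x : T -> R := fun z => (z == x)%:R.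

Lemma dirac_mass_torus_pmf x : dirac_mass x \in torus_pmf_set.
Proof.
rewrite inE; split=> [z|]; first by rewrite ler0n.
rewrite (bigD1 x) //= big1 ?addr0 /dirac_mass ?eqxx // => z /negPf ->.
by [].
Qed.

Definition dirac_pmf x : torus_pmf := SigSub (dirac_mass_torus_pmf x).

Definition average_mass x y (m : T -> R) : T -> R :=
  fun z => if (z == x) || (z == y) then 2^-1 * (m x + m y) else m z.

Lemma average_mass_torus_pmf x y (p : torus_pmf) :
  average_mass x y (mass p) \in torus_pmf_set.
Proof.
have [p0 p1] : (forall x, 0 <= mass p x) /\ \sum_x mass p x = 1.
  exact: set_mem (valP p).
rewrite inE; split=> [z|].
  rewrite /average_mass; case: ifP => _; last exact: p0.
  by rewrite mulr_ge0 ?invr_ge0 ?ler0n // addr_ge0 //; exact: p0.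
rewrite -[RHS]p1; have [<-|yx] := eqVneq x y.
  apply: eq_bigr => z _; rewrite /average_mass orbb.
  by case: eqP => [->|//]; field.
rewrite (bigD1 x) //= (bigD1 y) 1?eq_sym //= [RHS](bigD1 x) //=.
rewrite [X in _ = _ + X](bigD1 y) 1?eq_sym //= !addrA; congr (_ + _).
  by rewrite /average_mass !eqxx orbT /=; field.
apply: eq_bigr => z /andP[/negPf zx /negPf zy].
by rewrite /average_mass zx zy.
Qed.

Definition average x y (p : torus_pmf) : torus_pmf :=
  SigSub (average_mass_torus_pmf x y p).

Definition averaging_generator (f : torus_pmf -> R) (p : torus_pmf) : R :=
  2^-1 * \sum_(x : T) \sum_(y : T | torus_dist x y == 1%N)
    (f (average x y p) - f p).

Definition averaging_process disp (Omega : measurableType disp)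
    (P : probability Omega R) (p : torus_pmf)
    (eta : R -> Omega -> torus_pmf) : Prop :=
  markov_jump_process P averaging_generator p eta.

Definition random_walk disp (Omega : measurableType disp)
    (P : probability Omega R) (x : T) (X : R -> Omega -> discrete_topology T)
    : Prop :=
  markov_jump_process P rw_generator (x : discrete_topology T) X.

Definition law_of disp (Omega : measurableType disp) (P : probability Omega R)
    (Y : Omega -> T) (x : T) : R :=
  fine (P [set w | Y w = x]).

End torus.

Arguments uniform_mass R {d N} _.

(* Main.v *)
Require Import Defs.
From HB Require Import structures.
From mathcomp Require Import all_boot all_order all_algebra.
From mathcomp Require Import all_classical all_reals all_analysis.
From mathcomp Require Import measurable_realfun ring lra zify.
Set Implicit Arguments.
Unset Strict Implicit.
Unset Printing Implicit Defensive.
Import Order.TTheory GRing.Theory Num.Theory.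
Import numFieldNormedType.Exports.
Local Open Scope classical_set_scope.
Local Open Scope ring_scope.

(* For an even Fourier mode c_k of the torus with eigenvalue - lam_k, let y_k(t)
   be the expectation of sum_(x, y) c_k(y - x) eta_t(x) eta_t(y). When c_k is
   averaged over rotations of the coordinates it is constant on the unit
   vectors, and the generator closes:
     y_k' = - 2 lam_k y_k + lam_k g,    g = (d N^d)^-1 sum_k lam_k y_k,
   where g is a multiple of the expected Dirichlet form. For the random walk the
   same quantities solve y_k' = - 2 lam_k y_k, so that its Dirichlet form is the
   same multiple of h(t) = (d N^d)^-1 sum_k lam_k exp(- 2 lam_k t). Hence g
   solves the renewal equation g = h + (- h' / 2) * g, whose kernel has total
   mass 1/2. The lower bound follows by iterating the equation once.

   For the upper bound, let M be the maximum over [0, t] of g / (exp(b s) h) and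
   c a point where it is attained. The part of the convolution near time c is at
   most 5/8 M exp(b c) h(c), because h is almost constant at scale
   tau = del * min(c, N^2). The remaining part is O(h(c)) when c <= N^2, since
   sum_k y_k controls the integral of g; when c >= N^2 it is
   O(h(c)) + 1/8 M exp(b c) h(c) if b is a large multiple of N^-(d+2), because h
   decays like exp(- 2 mu t) with mu the spectral gap. So M is bounded. The only
   facts needed about h are its doubling property up to time N^2 and its size
   after N^2; they follow from the comparison of lam_k with |k|^2 / N^2. *)

(** * Differentiation on the half-line *)

Section halfline.
Context {R : realType}.
Implicit Types f g : R -> R.

(** Two-sided derivatives at positive times together with continuity up to 0: this is what the mean
    value argument on an interval starting at 0 consumes. *)
Definition halfline_derive f f' :=
  (forall t : R, 0 < t -> is_derive t 1 f (f' t)) /\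
  {within `[0, +oo[, continuous f}.

Lemma halfline_derive_eq f g f' g' : f =1 g ->
  (forall t, 0 < t -> f' t = g' t) ->
  halfline_derive f f' -> halfline_derive g g'.
Proof.
move=> /funext <- fg' [df cf]; split => // t t0.
by rewrite -fg'//; exact: df.
Qed.

Lemma halfline_derive_cst (c : R) : halfline_derive (fun=> c) (fun=> 0).
Proof.
split=> [t _|]; first exact: is_derive_cst.
by apply: continuous_subspaceT => x; exact: cst_continuous.
Qed.

Lemma halfline_deriveD f g f' g' : halfline_derive f f' ->
  halfline_derive g g' ->
  halfline_derive (fun t => f t + g t) (fun t => f' t + g' t).
Proof.
move=> [df cf] [dg cg]; split=> [t t0|x].
  by have := df t t0; have := dg t t0 => ? ?; apply: is_deriveD.
by apply: cvgD; [exact: cf|exact: cg].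
Qed.

Lemma halfline_deriveM f g f' g' : halfline_derive f f' ->
  halfline_derive g g' ->
  halfline_derive (fun t => f t * g t) (fun t => f' t * g t + f t * g' t).
Proof.
move=> [df cf] [dg cg]; split=> [t t0|x].
  have := df t t0; have := dg t t0 => dgt dft.
  apply: (@is_derive_eq _ _ _ _ _ _ _ _ (is_deriveM dft dgt)).
  by rewrite addrC [g t *: _]mulrC.
by apply: cvgM; [exact: cf|exact: cg].
Qed.

Lemma halfline_deriveZ (c : R) f f' : halfline_derive f f' ->
  halfline_derive (fun t => c * f t) (fun t => c * f' t).
Proof.
move=> df; apply: halfline_derive_eq (halfline_deriveM (halfline_derive_cst c) df) => //.
by move=> t _ /=; rewrite mul0r add0r.
Qed.

Lemma halfline_deriveB f g f' g' : halfline_derive f f' ->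
  halfline_derive g g' ->
  halfline_derive (fun t => f t - g t) (fun t => f' t - g' t).
Proof.
move=> df dg.
apply: halfline_derive_eq (halfline_deriveD df (halfline_deriveZ (-1) dg)) => t /=;
by rewrite mulN1r.
Qed.

Lemma halfline_derive_sum (I : Type) (s : seq I) (P : pred I)
    (f f' : I -> R -> R) : (forall i, P i -> halfline_derive (f i) (f' i)) ->
  halfline_derive (fun t => \sum_(i <- s | P i) f i t)
                  (fun t => \sum_(i <- s | P i) f' i t).
Proof.
move=> df; elim: s => [|i s IH].
  by apply: halfline_derive_eq (halfline_derive_cst 0) => t; rewrite big_nil.
case: (boolP (P i)) => Pi.
  by apply: halfline_derive_eq (halfline_deriveD (df i Pi) IH) => t;
    rewrite big_cons Pi.
by apply: halfline_derive_eq IH => t; rewrite big_cons (negbTE Pi).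
Qed.

Lemma halfline_derive_expR (c : R) :
  halfline_derive (fun t => expR (c * t)) (fun t => c * expR (c * t)).
Proof.
have dl (t : R) : is_derive t 1 (fun s : R => c * s) c.
  apply: (@is_derive_eq _ _ _ _ _ _ _ _ (is_deriveZ c (is_derive_id t 1))).
  by rewrite /GRing.scale/= mulr1.
split=> [t _|].
  apply: (@is_derive_eq _ _ _ _ _ _ _ _
    (is_derive1_comp (is_derive_expR (c * t)) (dl t))).
  by rewrite mulrC.
apply: continuous_subspaceT => t; apply: continuous_comp.
  by apply: cvgM; [exact: cvg_cst|exact: cvg_id].
exact: continuous_expR.
Qed.

Lemma halfline_nonincreasing f f' (a b : R) : halfline_derive f f' ->
  0 <= a -> a <= b -> (forall t, a < t -> t < b -> f' t <= 0) -> f b <= f a.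
Proof.
move=> [df cf] a0 ab f'0.
have dab x : x \in `]a, b[%R -> 0 < x.
  by rewrite in_itv/= => /andP[ax _]; exact: le_lt_trans ax.
apply: (@ler0_derive1_le_cc _ f a b); rewrite ?in_itv/= ?lexx ?ab //.
- by move=> x /dab x0; have := df x x0; move=> [].
- move=> x xab; have x0 := dab _ xab; rewrite derive1E.
  have dfx := df x x0.
  rewrite derive_val; move: xab; rewrite in_itv/= => /andP[]; exact: f'0.
- apply: continuous_subspaceW cf => x /=; rewrite !in_itv/= andbT => /andP[ax _].
  exact: le_trans ax.
Qed.

Lemma halfline_nondecreasing f f' (a b : R) : halfline_derive f f' ->
  0 <= a -> a <= b -> (forall t, a < t -> t < b -> 0 <= f' t) -> f a <= f b.
Proof.
move=> df a0 ab f'0; rewrite -lerN2.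
have := halfline_nonincreasing (halfline_deriveZ (-1) df) a0 ab.
rewrite !mulN1r; apply=> t at_ tb.
by rewrite mulN1r oppr_le0 f'0.
Qed.

Lemma halfline_max f (t : R) : {within `[0, +oo[, continuous f} -> 0 <= t ->
  exists c : R, [/\ 0 <= c, c <= t & forall s, 0 <= s -> s <= t -> f s <= f c].
Proof.
move=> cf t0.
have [|c] := @EVT_max _ f 0 t t0.
  apply: continuous_subspaceW cf => x /=.
  by rewrite !in_itv/= andbT => /andP[].
rewrite in_itv/= => /andP[c0 ct] cmax; exists c; split=> // s s0 st.
by apply: cmax; rewrite in_itv/= s0.
Qed.

End halfline.

(** * The relaxation system and its renewal equation *)

(** Average the tangent-line bounds taken at the convex combination [m]: the linear terms cancel. *)
Lemma expR_convex {R : realType} (th a b : R) : 0 <= th -> th <= 1 ->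
  expR ((1 - th) * a + th * b) <= (1 - th) * expR a + th * expR b.
Proof.
move=> th0 th1; set m := (1 - th) * a + th * b.
have tangent x : expR m * (1 + (x - m)) <= expR x.
  have -> : expR x = expR m * expR (x - m) by rewrite -expRD addrC subrK.
  by rewrite ler_pM2l ?expR_gt0// expR_ge1Dx.
have th1' : 0 <= 1 - th by lra.
apply: le_trans (lerD (ler_wpM2l th1' (tangent a)) (ler_wpM2l th0 (tangent b))).
by rewrite le_eqVlt; apply/orP; left; apply/eqP; rewrite /m; ring.
Qed.

Section relaxation.
Context {R : realType} {K : finType}.
Context (lam : K -> R) (kap Lam : R) (y : K -> R -> R).
Implicit Types s t u a b : R.

(** [heat] and [flux] are the h and g of the overview; [kap] will be (d N^d)^-1 and - [lam k] the
    eigenvalue of mode k. *)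
Definition heat t := kap * \sum_k lam k * expR (- (2 * lam k) * t).
Definition flux t := kap * \sum_k lam k * y k t.

Context (lam_ge0 : forall k, 0 <= lam k) (lam_le : forall k, lam k <= Lam).
Context (kap_gt0 : 0 < kap) (kap_lam : kap * \sum_k lam k = 1).
Context (kap_card : kap * #|K|%:R <= 1).

Lemma kap_sum_le (f1 f2 : K -> R) : (forall k, f1 k <= f2 k) ->
  kap * \sum_k f1 k <= kap * \sum_k f2 k.
Proof. by move=> f12; rewrite ler_pM2l// ler_sum. Qed.

Lemma heat0 : heat 0 = 1.
Proof.
rewrite -kap_lam /heat; congr (_ * _); apply: eq_bigr => k _.
by rewrite mulr0 expR0 mulr1.
Qed.

Lemma heat_ge t : 0 <= t -> expR (- (2 * Lam) * t) <= heat t.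
Proof.
move=> t0; rewrite -[leLHS]mul1r -[X in X * _]kap_lam -mulrA mulr_suml.
apply: kap_sum_le => k; rewrite ler_wpM2l// ler_expR !mulNr lerN2 ler_wpM2r//.
by rewrite ler_pM2l// lam_le.
Qed.

Lemma heat_nonincreasing s t : s <= t -> heat t <= heat s.
Proof.
move=> st; apply: kap_sum_le => k; rewrite ler_wpM2l// ler_expR !mulNr lerN2.
by rewrite ler_wpM2l// mulr_ge0.
Qed.

Lemma heat_gt0 t : 0 < heat t.
Proof.
have [/heat_ge|t0] := leP 0 t; first by apply: lt_le_trans; exact: expR_gt0.
by rewrite (lt_le_trans _ (heat_nonincreasing (ltW t0)))// heat0 ltr01.
Qed.

Lemma heat_convex th s t : 0 <= th -> th <= 1 ->
  heat ((1 - th) * s + th * t) <= (1 - th) * heat s + th * heat t.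
Proof.
move=> th0 th1; rewrite /heat !(mulrCA _ kap) -mulrDr !mulr_sumr -big_split/=.
rewrite -mulr_sumr; apply: kap_sum_le => k.
rewrite !(mulrCA _ (lam k)) -mulrDr ler_wpM2l//.
apply: le_trans (expR_convex _ _ th0 th1).
by rewrite ler_expR le_eqVlt; apply/orP; left; apply/eqP; ring.
Qed.

Lemma halfline_derive_heat :
  halfline_derive heat
    (fun t => kap * \sum_k lam k * (- (2 * lam k) * expR (- (2 * lam k) * t))).
Proof.
apply/halfline_deriveZ/halfline_derive_sum => k _.
exact/halfline_deriveZ/halfline_derive_expR.
Qed.

Context (y0 : forall k, y k 0 = 1) (y_le1 : forall k t, 0 <= t -> y k t <= 1).
Context (dy : forall k, halfline_derive (y k)
  (fun t => - (2 * lam k) * y k t + lam k * flux t)).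
Context (flux_ge0 : forall t, 0 <= t -> 0 <= flux t).

Lemma flux_le1 t : 0 <= t -> flux t <= 1.
Proof.
move=> t0; rewrite -kap_lam; apply: kap_sum_le => k.
by rewrite -[leRHS]mulr1 ler_wpM2l// y_le1.
Qed.

Lemma halfline_derive_flux : halfline_derive flux
  (fun t => kap * \sum_k lam k * (- (2 * lam k) * y k t + lam k * flux t)).
Proof.
by apply/halfline_deriveZ/halfline_derive_sum => k _; exact/halfline_deriveZ.
Qed.

(** With the flux frozen at [a], the mode equation has the equilibrium [a / 2]. Hence the deviation
    from [a / 2], times the integrating factor, is monotone according to the sign of
    [flux t - a]. *)
Let halfline_derive_mode k (a : R) :
  halfline_derive (fun t => (y k t - a / 2) * expR (2 * lam k * t))
    (fun t => lam k * (flux t - a) * expR (2 * lam k * t)).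
Proof.
have := halfline_deriveM (halfline_deriveB (dy k) (halfline_derive_cst (a / 2)))
  (halfline_derive_expR (2 * lam k)).
by apply: halfline_derive_eq => // t _; field.
Qed.

Let mode_stepE k (a s t : R) :
  (y k t - a / 2 <= (y k s - a / 2) * expR (- (2 * lam k) * (t - s))) =
  ((y k t - a / 2) * expR (2 * lam k * t) <=
   (y k s - a / 2) * expR (2 * lam k * s)).
Proof.
rewrite -[RHS](ler_pM2r (expR_gt0 (- (2 * lam k) * t))) -!mulrA -!expRD.
congr (_ <= _ * _); last by congr expR; ring.
by rewrite [X in expR X](_ : _ = 0) ?expR0 ?mulr1//; ring.
Qed.

Let mode_step_geE k (a s t : R) :
  ((y k s - a / 2) * expR (- (2 * lam k) * (t - s)) <= y k t - a / 2) =
  ((y k s - a / 2) * expR (2 * lam k * s) <=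
   (y k t - a / 2) * expR (2 * lam k * t)).
Proof.
rewrite -[RHS](ler_pM2r (expR_gt0 (- (2 * lam k) * t))) -!mulrA -!expRD.
congr (_ * _ <= _); first by congr expR; ring.
by rewrite [X in expR X](_ : _ = 0) ?expR0 ?mulr1//; ring.
Qed.

Lemma mode_le k (a s t : R) : 0 <= s -> s <= t ->
  (forall u, s <= u -> u <= t -> flux u <= a) ->
  y k t - a / 2 <= (y k s - a / 2) * expR (- (2 * lam k) * (t - s)).
Proof.
move=> s0 st ga; rewrite mode_stepE.
apply: (halfline_nonincreasing (halfline_derive_mode k a)) => // u su ut.
rewrite pmulr_lle0 ?expR_gt0// mulr_ge0_le0// subr_le0 ga//; exact: ltW.
Qed.

Lemma mode_ge k (a s t : R) : 0 <= s -> s <= t ->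
  (forall u, s <= u -> u <= t -> a <= flux u) ->
  (y k s - a / 2) * expR (- (2 * lam k) * (t - s)) <= y k t - a / 2.
Proof.
move=> s0 st ga; rewrite mode_step_geE.
apply: (halfline_nondecreasing (halfline_derive_mode k a)) => // u su ut.
rewrite pmulr_lge0 ?expR_gt0// mulr_ge0// subr_ge0 ga//; exact: ltW.
Qed.

(** This is the comparison with zero flux, for which the solution started from 1 is the pure
    exponential. *)
Lemma mode_ge_heat k t : 0 <= t -> expR (- (2 * lam k) * t) <= y k t.
Proof.
move=> t0; have := @mode_ge k 0 0 t (lexx 0) t0.
rewrite !(mul0r, subr0, y0, mul1r); apply=> u u0 _; exact: flux_ge0.
Qed.

Lemma flux_ge_heat t : 0 <= t -> heat t <= flux t.
Proof.
by move=> t0; apply: kap_sum_le => k; rewrite ler_wpM2l// mode_ge_heat.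
Qed.

(* The renewal equation [g = h + k * g] with [k = - h' / 2], iterated once. *)
Lemma flux_ge t : 0 <= t -> heat t * (1 + (1 - heat t) / 2) <= flux t.
Proof.
move=> t0.
(* On [0, t] the flux at u is at least [heat u], hence at least the constant [heat t]. *)
have yk k : expR (- (2 * lam k) * t)
    + heat t / 2 * (1 - expR (- (2 * lam k) * t)) <= y k t.
  have := @mode_ge k (heat t) 0 t (lexx 0) t0.
  rewrite y0 subr0 => /(_ _)/wrap[|].
    by move=> u u0 ut; apply: le_trans (flux_ge_heat u0); exact: heat_nonincreasing.
  by move=> ?; lra.
apply: le_trans (kap_sum_le (fun k => ler_wpM2l (lam_ge0 k) (yk k))).
rewrite le_eqVlt; apply/orP; left; apply/eqP.
under eq_bigr do rewrite mulrDr (mulrCA (lam _)) mulrBr mulr1.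
rewrite big_split/= -mulr_sumr sumrB.
rewrite [LHS](_ : _ = heat t + heat t / 2 * (kap * \sum_k lam k - heat t)).
  by rewrite {1 3}/heat; ring.
by rewrite kap_lam; field.
Qed.

(** With s = min(t, 1) and x = 2 lam_k s <= 2 Lam, exp(-x) <= 1 / (1 + x) <= 1 - x / (1 + 2 Lam).
    Averaging with the weights [kap * lam k] leaves the sum of [kap * lam k * lam k], which is at
    least 1. *)
Lemma one_sub_heat_ge t : 0 <= t ->
  2 / (1 + 2 * Lam) * Num.min t 1 <= 1 - heat t.
Proof.
move=> t0; set s := Num.min t 1.
have s0 : 0 <= s by rewrite le_min t0 ler01.
have s1 : s <= 1 by rewrite ge_min lexx orbT.
have st : s <= t by rewrite ge_min lexx.
have [k0 _|K0] := pickP (@predT K); last first.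
  by move: kap_lam; rewrite big_pred0// mulr0 => /eqP; rewrite eq_sym oner_eq0.
have Lam0 : 0 <= Lam by apply: le_trans (lam_le k0).
have Lam1 : 0 < 1 + 2 * Lam by lra.
have expub k : expR (- (2 * lam k) * t) <= 1 - 2 * lam k * s / (1 + 2 * Lam).
  have ls0 : 0 <= 2 * lam k * s by rewrite !mulr_ge0.
  have lsL : 2 * lam k * s <= 2 * Lam.
    by rewrite -[leRHS]mulr1 ler_pM// ?mulr_ge0// ler_pM2l.
  apply: (@le_trans _ _ (expR (- (2 * lam k * s)))).
    by rewrite ler_expR mulNr lerN2 ler_wpM2l// mulr_ge0.
  apply: (@le_trans _ _ (1 + 2 * lam k * s)^-1).
    by rewrite expRN lef_pV2 ?posrE ?expR_gt0 ?expR_ge1Dx//; lra.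
  have -> : (1 + 2 * lam k * s)^-1 =
      1 - 2 * lam k * s / (1 + 2 * lam k * s).
    by field; apply: lt0r_neq0; lra.
  rewrite lerD2l lerN2 ler_wpM2l// lef_pV2 ?posrE//; lra.
(* [(lam k - 1) ^+ 2 >= 0] gives the lower bound [2 - kap * #|K|], where the last product is at most
   1. *)
have sq : 1 <= kap * \sum_k lam k * lam k.
  apply: (@le_trans _ _ (kap * \sum_k (2 * lam k - 1))).
    rewrite sumrB -mulr_sumr mulrBr (mulrCA kap) kap_lam sumr_const.
    by rewrite mulr1; move: kap_card; lra.
  by apply: kap_sum_le => k; rewrite -subr_ge0;
    rewrite [leRHS](_ : _ = (lam k - 1) ^+ 2) ?sqr_ge0//; ring.
have : heat t <= 1 - 2 / (1 + 2 * Lam) * s * (kap * \sum_k lam k * lam k).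
  apply: le_trans (kap_sum_le (fun k => ler_wpM2l (lam_ge0 k) (expub k))) _.
  rewrite le_eqVlt; apply/orP; left; apply/eqP.
  transitivity (kap * (\sum_k lam k -
    2 / (1 + 2 * Lam) * s * \sum_k lam k * lam k)); last first.
    by rewrite mulrBr kap_lam; ring.
  rewrite [X in _ - X]mulr_sumr -sumrB; congr (_ * _).
  by apply: eq_bigr => k _; ring.
have c0 : 0 <= 2 / (1 + 2 * Lam) * s by rewrite !mulr_ge0// invr_ge0 ltW.
have := ler_wpM2l c0 sq; rewrite mulr1; lra.
Qed.

Lemma flux_lower t : 0 <= t ->
  (1 + (1 + 2 * Lam)^-1 * Num.min t 1) * heat t <= flux t.
Proof.
move=> t0; apply: le_trans (flux_ge t0); rewrite mulrC.
rewrite ler_wpM2l ?(ltW (heat_gt0 t))// lerD2l.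
have := one_sub_heat_ge t0; rewrite -mulrA; lra.
Qed.

(** The total [w], which is [kap] times the sum of all modes, satisfies [w' = - flux]. Adding
    [lam k * w] to the excess of mode k over free decay cancels the source term and gives a
    nonincreasing quantity, which starts at no more than [lam k]. *)
Lemma mode_excess_le k t : 0 <= t ->
  y k t - expR (- (2 * lam k) * t) <= lam k.
Proof.
move=> t0.
pose w s := kap * \sum_k y k s.
have dw : halfline_derive w (fun t => - flux t).
  have := halfline_deriveZ kap (@halfline_derive_sum _ _ (index_enum K) predT _ _
    (fun k _ => dy k)).
  apply: halfline_derive_eq => // s s0.
  transitivity (-2 * flux s + kap * (\sum_k lam k) * flux s); last first.
    by rewrite kap_lam; ring.
  rewrite big_split/= mulrDr; congr (_ + _); last by rewrite -mulr_suml mulrA.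
  rewrite [RHS]mulrCA [X in _ = _ * X]mulr_sumr; congr (_ * _).
  by apply: eq_bigr => j _; ring.
have w0 s : 0 <= s -> 0 <= w s.
  move=> s0; rewrite mulr_ge0 ?(ltW kap_gt0)// sumr_ge0// => j _.
  by apply: le_trans (mode_ge_heat j s0); exact: expR_ge0.
have df := halfline_deriveD (halfline_deriveB (dy k)
  (halfline_derive_expR (- (2 * lam k)))) (halfline_deriveZ (lam k) dw).
have : y k t - expR (- (2 * lam k) * t) + lam k * w t <=
       y k 0 - expR (- (2 * lam k) * 0) + lam k * w 0.
  apply: (halfline_nonincreasing df) => // s s0 st.
  rewrite [leLHS](_ : _ =
    - ((2 * lam k) * (y k s - expR (- (2 * lam k) * s)))); last by ring.
  by rewrite oppr_le0 mulr_ge0// ?mulr_ge0// subr_ge0 mode_ge_heat// ltW.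
rewrite y0 mulr0 expR0 subrr add0r.
have -> : w 0 = kap * #|K|%:R.
  rewrite /w; congr (_ * _); rewrite -sum1_card natr_sum.
  by apply: eq_bigr => j _; rewrite y0.
have := ler_wpM2l (lam_ge0 k) kap_card; have := mulr_ge0 (lam_ge0 k) (w0 _ t0).
rewrite mulr1; lra.
Qed.

(** * Upper bound on the flux, from heat bounds at the scale [T] (later N^2) and the spectral gap
    [mu] *)

Context (T D A C mu : R) (T1 : 1 <= T) (C0 : 0 < C) (mu0 : 0 <= mu).
Context (muT : mu * T <= 32) (gap : forall k, lam k = 0 \/ mu <= lam k).
Context (heat_half : forall t, 0 <= t -> t <= T -> heat (t / 2) <= D * heat t).
Context (heat_le : forall t, T / 2 <= t -> heat t <= A * expR (- (2 * mu) * t)).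
Context (heat_geA : forall t, 0 <= t -> A * expR (- (2 * mu) * t) <= C * heat t).

Let D_ge1 : 1 <= D.
Proof.
have := @heat_half 0 (lexx 0) (le_trans ler01 T1).
by rewrite mul0r heat0 mulr1.
Qed.

Let A_gt0 : 0 < A.
Proof.
have hT : T / 2 <= T by have := T1; lra.
rewrite -(pmulr_lgt0 _ (expR_gt0 (- (2 * mu) * T))).
by apply: lt_le_trans (heat_le hT); exact: heat_gt0.
Qed.

Lemma heat_halfn n t : 0 <= t -> t <= T -> heat (t / 2 ^+ n) <= D ^+ n * heat t.
Proof.
elim: n t => [|n IH] t t0 tT; first by rewrite !expr0 divr1 mul1r.
rewrite (_ : t / 2 ^+ n.+1 = t / 2 / 2 ^+ n); last first.
  by rewrite exprS invfM mulrA.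
have h2 : 0 <= t / 2 by lra.
have h3 : t / 2 <= T by lra.
apply: le_trans (IH _ h2 h3) _.
by rewrite exprSr -mulrA ler_wpM2l ?heat_half// exprn_ge0// (le_trans ler01).
Qed.

(* Convexity compares a small step back in time with a halving. *)
Lemma heat_back del t : 0 <= del -> del <= 1 / 2 -> 1 <= t ->
  heat (t - del * Num.min t T) <=
  (1 + 2 * del * Num.max D (C * expR 32)) * heat t.
Proof.
move=> del0 del1 t1; set m := Num.min t T; set D1 := Num.max _ _.
(* For t <= T this is the doubling bound; beyond T, heat is comparable to
   [A * expR (- (2 * mu) * t)], and going back by T / 2 costs exp(mu T) <= exp 32. *)
have hm : heat (t - m / 2) <= D1 * heat t.
  have ht0 := ltW (heat_gt0 t).
  have [tT|Tt] := leP t T.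
    have -> : m = t by apply/min_idPl.
    rewrite [t - _](_ : _ = t / 2); last by field.
    apply: le_trans (heat_half _ tT) _; first lra.
    by rewrite ler_wpM2r// le_max lexx.
  have -> : m = T by apply/min_idPr/ltW.
  have hT : T / 2 <= t - T / 2 by have := Tt; lra.
  apply: le_trans (heat_le hT) _.
  rewrite (_ : - (2 * mu) * (t - T / 2) = - (2 * mu) * t + mu * T); last by field.
  rewrite expRD mulrA.
  apply: (@le_trans _ _ (C * heat t * expR 32)).
    rewrite ler_pM ?expR_ge0 ?ler_expR ?heat_geA ?mulr_ge0 ?expR_ge0
      ?(ltW A_gt0)//; have := T1; have := muT; lra.
  by rewrite mulrAC ler_wpM2r// le_max lexx orbT.
have d0 : 0 <= 2 * del by lra.
have d1 : 2 * del <= 1 by lra.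
have := heat_convex t (t - m / 2) d0 d1.
rewrite (_ : (1 - 2 * del) * t + 2 * del * (t - m / 2) = t - del * m); last by field.
have := ler_wpM2l d0 hm.
have : 0 <= 2 * del * heat t by rewrite mulr_ge0// ltW// heat_gt0.
by move=> ? ? ?; lra.
Qed.

(** The bound x exp(-x) <= 1 with x = lam_k tau trades the extra rate and half of the exponential
    for 1 / tau. *)
Lemma heat_weight_le tau : 0 < tau ->
  kap * \sum_k lam k * (expR (- (2 * lam k) * tau) * lam k) <= heat (tau / 2) / tau.
Proof.
move=> tau0; rewrite ler_pdivlMr// -mulrA mulr_suml.
apply: kap_sum_le => k; rewrite -!mulrA ler_wpM2l//.
rewrite (_ : - (2 * lam k) * tau = - (2 * lam k) * (tau / 2) + - (lam k * tau)).
  rewrite expRD -mulrA ler_piMr ?expR_ge0//.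
  rewrite expRN mulrC ler_pdivrMr ?expR_gt0// mul1r.
  by apply: le_trans (expR_ge1Dx _); rewrite lerDr ler01.
by field.
Qed.

(** Restart the modes at time s: a flux bounded by [a] contributes at most a / 2, the free part
    rebuilds [heat t], and the excess at time s is damped over t - s. The bound on the excess is
    weighted by [lam k] because the late estimate covers only nonzero rates. *)
Lemma flux_step (a s t : R) (z : K -> R) : 0 <= s -> s <= t ->  0 <= a ->
  (forall u, s <= u -> u <= t -> flux u <= a) ->
  (forall k, lam k * (y k s - expR (- (2 * lam k) * s)) <= lam k * z k) ->
  flux t <= a / 2 + heat t +
    kap * \sum_k lam k * (expR (- (2 * lam k) * (t - s)) * z k).
Proof.
move=> s0 st a0 ga yz.
have yk k : lam k * y k t <= lam k * (a / 2) +
    lam k * expR (- (2 * lam k) * t) +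
    lam k * (expR (- (2 * lam k) * (t - s)) * z k).
  have /(ler_wpM2l (lam_ge0 k)) := mode_le k s0 st ga.
  have := ler_wpM2r (expR_ge0 (- (2 * lam k) * (t - s))) (yz k).
  have -> : expR (- (2 * lam k) * t) =
      expR (- (2 * lam k) * s) * expR (- (2 * lam k) * (t - s)).
    by rewrite -expRD; congr expR; ring.
  have : 0 <= lam k * (a / 2 * expR (- (2 * lam k) * (t - s))).
    by rewrite !mulr_ge0 ?expR_ge0//; lra.
  by move=> ? ? ?; lra.
apply: le_trans (kap_sum_le yk) _.
rewrite big_split big_split/= !mulrDr -/(heat t) -mulr_suml mulrA kap_lam.
by rewrite mul1r.
Qed.

(** Multiply the excess by exp(2 mu s). As mu <= lam_k, its growth comes only from the source, which
    past T / 2 is at most [lam k * M * A * expR (b * s)] by [heat_le], with integral at most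
    [lam k * (M * A / b) * expR (b * u)]. At T / 2 the excess is at most [lam k], and the multiplier
    exp(mu T) is at most exp 32. *)
Lemma mode_excess_late_le b M t k u : 0 < b -> 0 <= M ->
  (forall s, 0 <= s -> s <= t -> flux s <= M * (expR (b * s) * heat s)) ->
  lam k != 0 -> T / 2 <= u -> u <= t ->
  y k u - expR (- (2 * lam k) * u) <=
  lam k * (expR (- (2 * mu) * u) * (expR 32 + M * A / b * expR (b * u))).
Proof.
move=> b0 M0 flux_le lk0 Tu ut; have T20 : 0 <= T / 2 by have := T1; lra.
have mulam : mu <= lam k by case: (gap k) lk0 => // ->; rewrite eqxx.
pose f s := expR (2 * mu * s) * (y k s - expR (- (2 * lam k) * s)) -
  lam k * (M * A / b) * expR (b * s).
have df := halfline_deriveB (halfline_deriveM (halfline_derive_expR (2 * mu))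
  (halfline_deriveB (dy k) (halfline_derive_expR (- (2 * lam k)))))
  (halfline_deriveZ (lam k * (M * A / b)) (halfline_derive_expR b)).
have : f u <= f (T / 2).
  apply: (halfline_nonincreasing df) => // s Ts su.
  have s0 : 0 <= s by lra.
  set z := y k s - _; set e := expR (2 * mu * s).
  rewrite [leLHS](_ : _ = lam k * (e * flux s - M * A * expR (b * s))
    - e * (2 * (lam k - mu) * z)); last first.
    by rewrite /z; field; exact: lt0r_neq0.
  have z0 : 0 <= z by rewrite subr_ge0 mode_ge_heat.
  have e0 : 0 <= e by exact: expR_ge0.
  rewrite subr_le0; apply: (@le_trans _ _ 0); last first.
    by rewrite mulr_ge0// mulr_ge0// mulr_ge0// subr_ge0.
  rewrite mulr_ge0_le0// subr_le0.
  have st : s <= t by lra.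
  apply: le_trans (ler_wpM2l e0 (flux_le _ s0 st)) _.
  rewrite [leRHS](_ : _ = e * (M * (expR (b * s) * (A * expR (- (2 * mu) * s))))).
    do 3 (rewrite ler_wpM2l ?expR_ge0//).
    by apply: heat_le; exact: ltW.
  rewrite [RHS](_ : _ = M * A * expR (b * s) * (e * expR (- (2 * mu) * s))).
    by rewrite /e -expRD mulNr addrN expR0 mulr1.
  by ring.
have : f (T / 2) <= lam k * expR 32.
  have c0 : 0 <= lam k * (M * A / b) * expR (b * (T / 2)).
    by rewrite mulr_ge0 ?expR_ge0// mulr_ge0// divr_ge0 ?mulr_ge0// ltW.
  apply: (@le_trans _ _ (expR (2 * mu * (T / 2)) *
    (y k (T / 2) - expR (- (2 * lam k) * (T / 2))))); first by rewrite lerBlDr lerDl.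
  rewrite mulrC ler_pM ?expR_ge0 ?mode_excess_le ?ler_expR//; last by have := muT; lra.
  by rewrite subr_ge0 mode_ge_heat.
move=> /[swap] /le_trans /[apply]; rewrite /f lerBlDr.
move=> /(ler_wpM2l (expR_ge0 (- (2 * mu) * u))).
rewrite [X in X <= _ -> _]mulrA -expRD mulNr addNr expR0 mul1r => /le_trans; apply.
by rewrite le_eqVlt; apply/orP; left; apply/eqP; ring.
Qed.

(** [E] comes from the kernel weight at scale [tau], [F] collects the constants lost after time T,
    and the lower bound on [b] makes the late contribution at most an eighth of the maximum. The
    term [expR (2 * Lam)] covers a maximum attained at c <= 1. *)
Lemma flux_upper_explicit (j : nat) b t :
  let E := D ^+ j.+1 * 2 ^+ j in let F := E * C * expR 32 in
  8 * Num.max D (C * expR 32) <= 2 ^+ j -> 0 < b -> 8 * F * A <= b -> 0 <= t ->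
  flux t <=
  (expR (2 * Lam) + 4 * (1 + F * expR 32 + E)) * expR (b * t) * heat t.
Proof.
move=> E F hj b0 hb t0.
have D0 : 0 < D by exact: lt_le_trans D_ge1.
have E0 : 0 < E by rewrite /E mulr_gt0 ?exprn_gt0.
have F0 : 0 < F by rewrite /F; do 2 (apply: mulr_gt0 => //); exact: expR_gt0.
have P0 s : 0 < expR (b * s) * heat s by rewrite mulr_gt0 ?expR_gt0 ?heat_gt0.
pose r s := flux s / (expR (b * s) * heat s).
have cr : {within `[0, +oo[, continuous r}.
  move=> x; apply: cvgM; first exact: halfline_derive_flux.2.
  apply: cvgV; first exact: lt0r_neq0.
  by apply: (halfline_deriveM (halfline_derive_expR b) halfline_derive_heat).2.
have [c [c0 ct rmax]] := halfline_max cr t0.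
set M := r c in rmax.
have M0 : 0 <= M by rewrite divr_ge0 ?flux_ge0// ltW.
have fM s : 0 <= s -> s <= t -> flux s <= M * (expR (b * s) * heat s).
  by move=> s0 st; rewrite -ler_pdivrMr//; exact: rmax.
apply: le_trans (fM t t0 (lexx t)) _.
rewrite -[leRHS]mulrA ler_wpM2r ?(ltW (P0 t))//.
have FF0 : 0 < F * expR 32 by rewrite mulr_gt0// expR_gt0.
have [c1|c1] := leP c 1.
  apply: (@le_trans _ _ (expR (2 * Lam))); last by lra.
  rewrite ler_pdivrMr//; apply: le_trans (flux_le1 c0) _.
  rewrite -[leLHS](_ : expR (2 * Lam) * (1 * expR (- (2 * Lam) * 1)) = 1); last first.
    by rewrite mul1r -expRD mulr1 subrr expR0.
  rewrite ler_wpM2l ?expR_ge0// ler_pM ?expR_ge0//.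
    by rewrite -expR0 ler_expR mulr_ge0// ltW.
  by apply: le_trans (heat_nonincreasing c1); exact: heat_ge.
apply: (@le_trans _ _ (4 * (1 + F * expR 32 + E))); last first.
  by rewrite lerDr expR_ge0.
have two_j : 0 < 2 ^+ j :> R by rewrite exprn_gt0.
(* Then m is halved j + 1 times to reach tau / 2, and by the choice of j a step back by tau
   multiplies heat by at most 5 / 4. *)
pose del : R := (2 ^+ j)^-1.
have del0 : 0 < del by rewrite invr_gt0.
have delE : del * 2 ^+ j = 1 by rewrite mulVf// lt0r_neq0.
have del_small : del * Num.max D (C * expR 32) <= 1 / 8.
  have := ler_wpM2l (ltW del0) hj; rewrite delE; lra.
have del8 : del <= 1 / 8.
  apply: le_trans del_small; rewrite ler_peMr ?(ltW del0)//.
  by rewrite le_max D_ge1.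
set m := Num.min c T.
have m1 : 1 <= m by rewrite le_min T1 ltW.
have mc : m <= c by rewrite ge_min lexx.
have mT : m <= T by rewrite ge_min lexx orbT.
pose tau := del * m.
have tau0 : 0 < tau by rewrite mulr_gt0//; lra.
have tau_m : tau <= m / 8.
  by have := ler_wpM2r (le_trans ler01 m1) del8; rewrite /tau; lra.
have tau_c : tau <= c / 8 by lra.
have tauV : tau^-1 <= 2 ^+ j.
  rewrite -[leRHS]invrK lef_pV2 ?posrE ?invr_gt0//.
  by rewrite -[leLHS]mulr1 ler_wpM2l// ltW.
have Dj0 : 0 <= D ^+ j.+1 by rewrite exprn_ge0// ltW.
have weight : heat (tau / 2) / tau <= E * heat m.
  have -> : tau / 2 = m / 2 ^+ j.+1 by rewrite /tau /del exprS invfM; field.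
  rewrite /E [leRHS]mulrAC; apply: (ler_pM (ltW (heat_gt0 _)) _ _ tauV).
    by rewrite invr_ge0 ltW.
  by apply: heat_halfn => //; lra.
pose u := c - tau.
have u0 : 0 <= u by rewrite /u; lra.
have uc : u <= c by rewrite /u; lra.
have ut : u <= t by rewrite /u; lra.
pose a := M * (expR (b * c) * heat u).
have a0 : 0 <= a by rewrite mulr_ge0// mulr_ge0 ?expR_ge0// ltW// heat_gt0.
have ga s : u <= s -> s <= c -> flux s <= a.
  move=> us sc; apply: le_trans (fM _ _ _) _; [lra|lra|].
  rewrite ler_wpM2l//; apply: ler_pM; rewrite ?expR_ge0 ?(ltW (heat_gt0 _))//.
    by rewrite ler_expR ler_pM2l.
  exact: heat_nonincreasing.
have hu : heat u <= 5 / 4 * heat c.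
  have := @heat_back del c (ltW del0) _ (ltW c1); rewrite -/m -/tau -/u.
  move=> /(_ _)/wrap[|]; first by lra.
  move=> /le_trans; apply; rewrite ler_pM2r ?heat_gt0//; lra.
have hc := heat_gt0 c.
set P := expR (b * c) * heat c.
have PE : heat c <= P.
  by rewrite ler_peMl ?(ltW hc)// -expR0 ler_expR mulr_ge0// ltW.
(* Since a / 2 is at most 5 / 8 of M P, the terms in M P add up to 3 / 4 of it; absorbing them
   produces the factor 4. *)
suff key : flux c <= a / 2 + heat c * (1 + F * expR 32 + E) + 1 / 8 * (M * P).
  have fc : flux c = M * P by rewrite /M /r divfK// lt0r_neq0.
  have aP : a <= 5 / 4 * (M * P).
    rewrite [leRHS](_ : _ = M * (expR (b * c) * (5 / 4 * heat c))).
      by rewrite !ler_wpM2l ?expR_ge0.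
    by rewrite /P; ring.
  rewrite -(ler_pM2r hc); apply: (@le_trans _ _ (M * P)).
    by rewrite ler_wpM2l.
  move: key; rewrite fc; lra.
(* Up to time T the uniform excess bound [lam k] suffices. *)
have [cT|Tc] := leP c T.
  have mE : m = c by apply/min_idPl.
  apply: (le_trans (flux_step (z := lam) u0 uc a0 ga _)).
    by move=> k; rewrite ler_wpM2l// mode_excess_le.
  have -> : c - u = tau by rewrite /u; ring.
  have := le_trans (heat_weight_le tau0) weight; rewrite mE.
  have : 0 <= M * P := mulr_ge0 M0 (ltW (P0 c)).
  have : 0 <= heat c * (F * expR 32) by apply: mulr_ge0; exact: ltW.
  by move=> ? ? ?; lra.
have mE : m = T by apply/min_idPr/ltW.
(* [lam k * Q] bounds the excess at time u by [mode_excess_late_le]. *)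
pose Q := expR (- (2 * mu) * u) * (expR 32 + M * A / b * expR (b * u)).
have MAb : 0 <= M * A / b := divr_ge0 (mulr_ge0 M0 (ltW A_gt0)) (ltW b0).
have Q0 : 0 <= Q.
  by rewrite mulr_ge0 ?expR_ge0// addr_ge0 ?expR_ge0// mulr_ge0 ?expR_ge0.
have Tu : T / 2 <= u by rewrite /u; lra.
apply: le_trans (flux_step (z := fun k => lam k * Q) u0 uc a0 ga _) _.
  move=> k; have [->|lk0] := eqVneq (lam k) 0; first by rewrite !mul0r.
  by rewrite ler_wpM2l// /Q (@mode_excess_late_le b M t).
have -> : c - u = tau by rewrite /u; ring.
set S := kap * _.
have {S} -> : S = kap * (\sum_k lam k * (expR (- (2 * lam k) * tau) * lam k)) * Q.
  by rewrite /S -mulrA mulr_suml; congr (_ * _); apply: eq_bigr => k _; ring.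
have SQ := ler_wpM2r Q0 (le_trans (heat_weight_le tau0) weight).
(* Replacing [heat m] by [A] makes A exp(-2 mu u) appear in the product with [Q], and that is
   comparable to [heat c]. *)
have hT : heat m <= A.
  rewrite mE; apply: (@le_trans _ _ (A * expR (- (2 * mu) * T))).
    by apply: heat_le; have := T1; lra.
  rewrite ler_piMr ?(ltW A_gt0)// -expR0 ler_expR mulNr oppr_le0 mulr_ge0//.
    by rewrite mulr_ge0.
  by have := T1; lra.
have Au : A * expR (- (2 * mu) * u) <= C * heat c * expR 32.
  rewrite (_ : - (2 * mu) * u = - (2 * mu) * c + 2 * mu * tau); last by rewrite /u; ring.
  rewrite expRD mulrA.
  apply: (ler_pM (mulr_ge0 (ltW A_gt0) (expR_ge0 _)) (expR_ge0 _) (heat_geA c0)).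
  rewrite ler_expR; have := muT; have := ler_wpM2l mu0 tau_m.
  have := ler_wpM2l mu0 mT; have := T1; have := mu0.
  by move=> ? ? ? ? ?; lra.
have AQ : A * Q <= C * heat c * expR 32 * (expR 32 + M * A / b * expR (b * c)).
  rewrite /Q [leLHS]mulrA; apply: (ler_pM _ _ Au).
  - exact: mulr_ge0 (ltW A_gt0) (expR_ge0 _).
  - exact: addr_ge0 (expR_ge0 _) (mulr_ge0 MAb (expR_ge0 _)).
  - by rewrite lerD2l ler_wpM2l// ler_expR ler_pM2l.
have FA : F * (M * A / b) <= 1 / 8 * M.
  rewrite -mulrA mulrCA [leRHS]mulrC ler_wpM2l// mulrA ler_pdivrMr//; lra.
have EQ : E * heat m * Q <= heat c * (F * expR 32) + 1 / 8 * (M * P).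
  apply: (@le_trans _ _ (E * (A * Q))).
    by rewrite -mulrA ler_pM2l// ler_wpM2r.
  apply: le_trans (ler_wpM2l (ltW E0) AQ) _.
  rewrite [leLHS](_ : _ = heat c * (F * expR 32) + F * (M * A / b) * P); last first.
    by rewrite /F /P; ring.
  by rewrite lerD2l [leRHS]mulrA; apply: ler_wpM2r => //; exact: ltW (P0 c).
have : 0 <= heat c * E := mulr_ge0 (ltW hc) (ltW E0).
by move=> ?; lra.
Qed.

End relaxation.

(** * Cosine modes on the cycle *)

Section cosine_bounds.
Context {R : realType}.
Implicit Types x th : R.

Lemma halfline_derive_sin : halfline_derive (@sin R) (@cos R).
Proof.
split=> [t _|]; first exact: is_derive_sin.
by apply: continuous_subspaceT => x; exact: continuous_sin.
Qed.

Lemma halfline_derive_cos : halfline_derive (@cos R) (fun t => - sin t).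
Proof.
split=> [t _|]; first exact: is_derive_cos.
by apply: continuous_subspaceT => x; exact: continuous_cos.
Qed.

Lemma halfline_derive_id : halfline_derive (@id R) (fun=> 1).
Proof.
split=> [t _|]; first exact: is_derive_id.
by apply: continuous_subspaceT => x; exact: cvg_id.
Qed.

Lemma sin_le_id x : 0 <= x -> sin x <= x.
Proof.
move=> x0; rewrite -subr_ge0.
have /(_ 0 x (lexx 0) x0) := halfline_nondecreasing
  (halfline_deriveB halfline_derive_id halfline_derive_sin).
by rewrite sin0 subrr; apply=> t _ _; rewrite subr_ge0 cos_le1.
Qed.

Lemma one_sub_cos_le th : 0 <= th -> 1 - cos th <= th ^+ 2 / 2.
Proof.
move=> th0; rewrite -subr_ge0.
have dq := halfline_deriveZ 2^-1 (halfline_deriveM halfline_derive_id halfline_derive_id).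
have /(_ 0 th (lexx 0) th0) := halfline_nondecreasing
  (halfline_deriveB dq (halfline_deriveB (halfline_derive_cst 1) halfline_derive_cos)).
rewrite /= cos0 expr2 => /(_ _)/wrap[|]; last by lra.
by move=> t t0 _; have := sin_le_id (ltW t0); lra.
Qed.

(** From sin x >= x - x^3 / 6 and x^2 <= 4. *)
Lemma sin_ge_third x : 0 <= x -> x <= 2 -> x / 3 <= sin x.
Proof.
move=> x0 x2.
have dc := halfline_deriveM halfline_derive_id
  (halfline_deriveM halfline_derive_id halfline_derive_id).
have /(_ 0 x (lexx 0) x0) := halfline_nondecreasing (halfline_deriveB
  halfline_derive_sin (halfline_deriveB halfline_derive_id (halfline_deriveZ 6^-1 dc))).
rewrite /= sin0 => /(_ _)/wrap[|].
  by move=> t t0 _; have := one_sub_cos_le (ltW t0); rewrite expr2; lra.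
have : x * (x * x) <= x * (2 * 2) by rewrite ler_wpM2l// ler_pM.
by move=> ? ?; lra.
Qed.

(** 1 - cos th = 2 sin(th / 2)^2, and th / 2 <= 2 since pi < 4. *)
Lemma one_sub_cos_ge th : 0 <= th -> th <= pi -> th ^+ 2 / 18 <= 1 - cos th.
Proof.
move=> th0 thpi; have := @pihalf_lt2 R => pi2.
have h0 : 0 <= th / 2 by lra.
have h2 : th / 2 <= 2 by lra.
rewrite -{2}[th](_ : (th / 2) *+ 2 = th); last by rewrite mulr2n -splitr.
rewrite cos_mulr2n cos2sin2.
have s3 := sin_ge_third h0 h2; have s0 : 0 <= th / 2 / 3 by lra.
have := ler_pM s0 s0 s3 s3.
by rewrite !expr2 -mulr_natr; lra.
Qed.

End cosine_bounds.

Section absZ.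
Context (n : nat).
Local Notation N := n.+3.
Implicit Types k : 'Z_N.

(** Distance from k to 0 on the cycle, as in [torus_dist]; the form [n.+3] of N keeps 1 and -1
    distinct. *)
Definition absZ k : nat := minn k (N - k).

Lemma absZ_le k : (2 * absZ k <= N)%N.
Proof. by rewrite /absZ; have := ltn_ord k; rewrite /= ; lia. Qed.

End absZ.

Section cosine_modes.
Context {R : realType} (n : nat).
Local Notation N := n.+3.
Implicit Types k z : 'Z_N.

Definition cosmode k z : R := cos (2 * pi * (k%:R * z%:R) / N%:R).

Let natN0 : N%:R != 0 :> R. Proof. by rewrite pnatr_eq0. Qed.

Lemma cos_period (x : R) (q : nat) : cos (x + 2 * pi * q%:R) = cos x.
Proof.
elim: q => [|q IH]; first by rewrite mulr0 addr0.
rewrite -[q.+1%:R]natr1 mulrDr [_ * 1]mulr1 addrA.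
by rewrite [2 * pi](mulr_natl pi 2) cosD2pi -[pi *+ 2]mulr_natl.
Qed.

(** Reducing a factor modulo N changes the angle by a multiple of 2 pi, so identities can be checked
    on natural representatives. *)
Lemma cosmode_nat (a b : nat) :
  cos (2 * pi * (a%:R * b%:R) / N%:R) = cosmode (inZp a) (inZp b).
Proof.
have modl (c e : nat) :
    cos (2 * pi * (c%:R * e%:R) / N%:R) = cos (2 * pi * ((c %% N)%:R * e%:R) / N%:R) :> R.
  rewrite {1}(divn_eq c N) -[RHS](cos_period _ (c %/ N * e)%N); congr cos.
  by rewrite natrD !natrM; move: natN0; move: (N%:R : R) => M M0; field.
by rewrite modl [_ * b%:R]mulrC modl [_ * (a %% N)%:R]mulrC.
Qed.

Lemma cosmodeC k z : cosmode k z = cosmode z k.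
Proof. by rewrite /cosmode [k%:R * _]mulrC. Qed.

Lemma cosmode0 k : cosmode k 0 = 1.
Proof. by rewrite /cosmode !mulr0 mul0r cos0. Qed.

Lemma cosmodeDn k z (m : nat) : cosmode k (z + inZp m) =
  cos (2 * pi * (k%:R * z%:R) / N%:R + 2 * pi * (k%:R * m%:R) / N%:R).
Proof.
have := cosmode_nat k (z + m)%N.
rewrite (_ : inZp k = k); last by rewrite valZpK.
rewrite (_ : inZp (z + m)%N = z + inZp m); last first.
  by apply/val_inj; rewrite /= modnDmr.
by move=> <-; congr cos; rewrite natrD; move: natN0; move: (N%:R : R) => M M0; field.
Qed.

Lemma cosmodeN k z : cosmode k (- z) = cosmode k z.
Proof.
have zN : (z <= N)%N by rewrite ltnW.
have -> : - z = 0 + inZp (N - z)%N by rewrite add0r; apply/val_inj.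
rewrite cosmodeDn mulr0 mulr0 mul0r add0r natrB// /cosmode -[RHS]cosN.
rewrite -[RHS](cos_period _ k); congr cos.
by move: natN0; move: (N%:R : R) => M M0; field.
Qed.

(** With z - 1 written as z + (N - 1), this is the addition formula for cosines: the modes are
    eigenvectors of the second difference. *)
Lemma cosmodeD1 k z :
  cosmode k (z + 1) + cosmode k (z - 1) = 2 * cosmode k 1 * cosmode k z.
Proof.
have -> : z - 1 = z + inZp N.-1.
  by congr (_ + _); apply/val_inj.
have one : (1 : 'Z_N) = inZp 1 by apply/val_inj.
rewrite {1}one !cosmodeDn.
set x := 2 * pi * _ / _; set w := 2 * pi * (k%:R * 1%:R) / N%:R.
rewrite (_ : _ + 2 * pi * (k%:R * N.-1%:R) / N%:R = (x - w) + 2 * pi * k%:R); last first.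
  rewrite (_ : N.-1%:R = N%:R - 1 :> R); last by rewrite -[N%:R]natr1 addrK.
  by rewrite /w; move: natN0; move: (N%:R : R) => M M0; field.
rewrite cos_period cosD cosB.
have -> : cosmode k 1 = cos w by rewrite /cosmode.
by rewrite -/(cosmode k z) /x /cosmode; ring.
Qed.

(** Minus the eigenvalue of half the second difference on the cycle. *)
Definition cosrate k : R := 1 - cosmode k 1.

Lemma rate_ge0 k : 0 <= cosrate k.
Proof. by rewrite subr_ge0 cos_le1. Qed.

Lemma rate_le2 k : cosrate k <= 2.
Proof.
rewrite /cosrate /cosmode.
by have := @cos_geN1 R (2 * pi * (k%:R * (1%R : 'Z_N)%:R) / N%:R); lra.
Qed.

Lemma rate0 : cosrate 0 = 0.
Proof. by rewrite /cosrate cosmodeC cosmode0 subrr. Qed.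

Lemma rateE k : cosrate k = 1 - cos (2 * pi * (absZ k)%:R / N%:R).
Proof.
rewrite /cosrate; congr (1 - _).
have E j : cosmode j 1 = cos (2 * pi * (j : nat)%:R / N%:R) by rewrite /cosmode mulr1.
rewrite /absZ; case: leqP => _; first exact: E.
have kN : (k <= N)%N by rewrite ltnW.
rewrite E natrB// -[RHS]cosN -[RHS](cos_period _ 1); congr cos.
by move: natN0; move: (N%:R : R) => M M0; field.
Qed.

Let angle_ge0 (a : nat) : 0 <= 2 * pi * a%:R / N%:R :> R.
Proof. by rewrite !mulr_ge0 ?invr_ge0 ?pi_ge0. Qed.

Let angle_le_pi (a : nat) : (2 * a <= N)%N -> 2 * pi * a%:R / N%:R <= pi :> R.
Proof.
move=> aN; rewrite ler_pdivrMr ?ltr0n//.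
rewrite [leLHS](_ : _ = pi * (2 * a)%:R); last by rewrite natrM; ring.
by rewrite ler_pM2l ?pi_gt0// ler_nat.
Qed.

Definition rate_nat (a : nat) : R := 1 - cos (2 * pi * a%:R / N%:R).

Lemma rate_natE k : cosrate k = rate_nat (absZ k). Proof. exact: rateE. Qed.

Lemma rate_nat_mono (a b : nat) : (a <= b)%N -> (2 * b <= N)%N ->
  rate_nat a <= rate_nat b.
Proof.
move=> ab bN; have aN : (2 * a <= N)%N by apply: leq_trans bN; rewrite leq_mul2l.
rewrite lerD2l lerN2 leNgt ltr_cos ?in_itv/= ?angle_ge0 ?angle_le_pi// -leNgt.
by rewrite !ler_pM ?mulr_ge0 ?pi_ge0 ?invr_ge0 ?ler_nat.
Qed.

(** The constants here and in [rate_nat_ge] come from the quadratic bounds on 1 - cos and from 2 <=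
    pi <= 4. *)
Lemma rate_nat_le (a : nat) : rate_nat a <= 32 * a%:R ^+ 2 / N%:R ^+ 2.
Proof.
apply: le_trans (one_sub_cos_le (angle_ge0 a)) _.
have pi4 : pi <= 4 :> R by have := @pihalf_lt2 R; lra.
have p2 : pi * pi <= 16 :> R.
  by rewrite (_ : 16 = 4 * 4) ?ler_pM ?pi_ge0//; ring.
have N2 : 0 <= a%:R ^+ 2 / N%:R ^+ 2 :> R by rewrite mulr_ge0 ?invr_ge0 ?sqr_ge0.
have := ler_wpM2r N2 p2.
rewrite (_ : (2 * pi * a%:R / N%:R) ^+ 2 / 2 = 2 * (pi * pi * (a%:R ^+ 2 / N%:R ^+ 2))).
  by rewrite -[32 * _ / _]mulrA; move: (_ / _) => q; lra.
by move: natN0; move: (N%:R : R) => M M0; field.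
Qed.

Lemma rate_nat_ge (a : nat) : (2 * a <= N)%N ->
  a%:R ^+ 2 / (2 * N%:R ^+ 2) <= rate_nat a.
Proof.
move=> aN; apply: le_trans (one_sub_cos_ge (angle_ge0 a) (angle_le_pi aN)).
have p2 : 4 <= pi * pi :> R.
  by rewrite (_ : 4 = 2 * 2) ?ler_pM ?pi_ge2//; ring.
have N2 : 0 <= a%:R ^+ 2 / N%:R ^+ 2 :> R by rewrite mulr_ge0 ?invr_ge0 ?sqr_ge0.
have := ler_wpM2r N2 p2.
rewrite (_ : (2 * pi * a%:R / N%:R) ^+ 2 / 18 =
    4 / 18 * (pi * pi * (a%:R ^+ 2 / N%:R ^+ 2))).
  rewrite (_ : a%:R ^+ 2 / (2 * N%:R ^+ 2) = 2^-1 * (a%:R ^+ 2 / N%:R ^+ 2)).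
    by move: N2; move: (a%:R ^+ 2 / _) => q; lra.
  by move: natN0; move: (N%:R : R) => M M0; field.
by move: natN0; move: (N%:R : R) => M M0; field.
Qed.

(** Dividing the distance by 8 divides its square by at least 64, which outweighs the factor 9
    between the two quadratic bounds on 1 - cos times the factor 4. *)
Lemma rate_nat_div8 (a : nat) : (2 * a <= N)%N ->
  4 * rate_nat (a %/ 8) <= rate_nat a.
Proof.
move=> aN; apply: le_trans (one_sub_cos_ge (angle_ge0 a) (angle_le_pi aN)).
have := one_sub_cos_le (angle_ge0 (a %/ 8)); rewrite -/(rate_nat (a %/ 8)).
set x := 2 * pi * (a %/ 8)%:R / N%:R; set z := 2 * pi * a%:R / N%:R.
have xz : x * 8 <= z.
  rewrite (_ : x * 8 = 2 * pi * (a %/ 8 * 8)%:R / N%:R); last first.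
    by rewrite /x natrM; ring.
  rewrite /z ler_wpM2r ?invr_ge0// ler_wpM2l ?mulr_ge0 ?pi_ge0//.
  by rewrite ler_nat leq_trunc_div.
have x0 : 0 <= x by exact: angle_ge0.
have x8 : 0 <= x * 8 by rewrite mulr_ge0.
have := ler_pM x8 x8 xz xz; rewrite !expr2.
have := mulr_ge0 x0 x0.
by move=> ? ? ?; lra.
Qed.

(** Shifting k by 1 or -1 leaves the sum S unchanged, so the second difference gives (1 - cosmode z
    1) S = 0; the first factor is positive unless z = 0. *)
Lemma sum_cosmode z : \sum_k cosmode k z = (z == 0)%:R * N%:R.
Proof.
have [->|z0] := eqVneq z 0.
  under eq_bigr do rewrite cosmode0.
  by rewrite mul1r sumr_const card_ord.
set S := \sum_k _.
have SS : S + S = 2 * cosmode z 1 * S.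
  have S1 : S = \sum_k cosmode z (k + 1).
    by rewrite /S (reindex_inj (addIr 1)); apply: eq_bigr => k _; exact: cosmodeC.
  have S2 : S = \sum_k cosmode z (k - 1).
    by rewrite /S (reindex_inj (addIr (- 1))); apply: eq_bigr => k _; exact: cosmodeC.
  rewrite {1}S1 S2 -big_split /= (eq_bigr _ (fun k _ => cosmodeD1 z k)) -mulr_sumr.
  by congr (_ * _); rewrite -S2 /S; apply: eq_bigr => k _; exact: cosmodeC.
have c1 : cosmode z 1 != 1.
  rewrite -subr_eq0 -opprB oppr_eq0 -/(cosrate z) rate_natE gt_eqF//.
  apply: lt_le_trans (rate_nat_ge (absZ_le z)).
  have a0 : (0 < absZ z)%N by rewrite /absZ leq_min subn_gt0 ltn_ord andbT lt0n.
  by rewrite divr_gt0 ?mulr_gt0 ?exprn_gt0 ?ltr0n.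
rewrite [RHS]mul0r; apply/eqP.
have /eqP : (1 - cosmode z 1) * S = 0 by lra.
by rewrite mulf_eq0 subr_eq0 eq_sym (negbTE c1).
Qed.

End cosine_modes.

(** * Theta sums of the cycle: doubling and diffusive-scale bounds *)

Section theta_sums.
Context {R : realType} (n : nat).
Local Notation N := n.+3.
Local Notation cosrate := (@cosrate R n).
Local Notation rate_nat := (@rate_nat R n).
Implicit Types (k : 'Z_N) (s : R).

(** Trace of the heat semigroup on the cycle; [theta'] is minus its derivative. *)
Definition theta s := \sum_k expR (- cosrate k * s).
Definition theta' s := \sum_k cosrate k * expR (- cosrate k * s).

Lemma absZ1 : absZ (1 : 'Z_N) = 1%N.
Proof. by []. Qed.

Lemma rate1 : cosrate 1 = rate_nat 1.
Proof. by rewrite rate_natE absZ1. Qed.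

Lemma rate_nat_ge0 (a : nat) : 0 <= rate_nat a.
Proof. by rewrite subr_ge0 cos_le1. Qed.

Lemma gap_le : rate_nat 1 * N%:R ^+ 2 <= 32.
Proof.
have := @rate_nat_le R n 1; rewrite -ler_pdivlMr ?exprn_gt0 ?ltr0n//.
by rewrite expr1n mulr1.
Qed.

Lemma gap_ge : N%:R ^- 2 <= 2 * rate_nat 1.
Proof.
have N2 : (2 * 1 <= N)%N by lia.
have := @rate_nat_ge R n 1 N2; rewrite expr1n div1r invfM.
by set q := (_ ^- 2); lra.
Qed.

Lemma gap_gt0 : 0 < rate_nat 1.
Proof.
have := gap_ge; have : 0 < N%:R ^- 2 :> R by rewrite invr_gt0 exprn_gt0 ?ltr0n.
by set q := (_ ^- 2); lra.
Qed.

Lemma rate_gap k : k != 0 -> rate_nat 1 <= cosrate k.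
Proof.
move=> k0; rewrite rate_natE rate_nat_mono ?absZ_le//.
by rewrite /absZ leq_min subn_gt0 ltn_ord andbT lt0n.
Qed.

(** Each value of the quotient by 8 is taken by at most 16 frequencies: within a fibre, [g] recovers
    a frequency from its side of the cycle and a remainder modulo 8. *)
Lemma sum_div8_le (f : nat -> R) : (forall a, 0 <= f a) ->
  \sum_(k : 'Z_N) f (absZ k %/ 8)%N <= 16 * \sum_(k : 'Z_N) f (absZ k).
Proof.
move=> f0.
pose phi k : 'Z_N := inord (absZ k %/ 8).
have phiE k : (phi k : nat) = (absZ k %/ 8)%N.
  have kN : (absZ k %/ 8 < N)%N by have := absZ_le k; lia.
  by rewrite /phi inordK.
have absphi k : absZ (phi k) = (absZ k %/ 8)%N.
  by rewrite /absZ phiE; apply/minn_idPl; have := absZ_le k; lia.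
rewrite (partition_big phi predT)//= mulr_sumr; apply: ler_sum => j _.
rewrite (eq_bigr (fun=> f (absZ j))); last first.
  by move=> k /eqP <-; rewrite absphi.
rewrite sumr_const -[leLHS]mulr_natl. rewrite ler_wpM2r// (ler_nat _ _ 16).
pose g k : bool * 'I_8 := ((k <= N - k)%N, inord (absZ k %% 8)).
have ginj : {in [set k | phi k == j] &, injective g}.
  move=> k1 k2; rewrite !inE => /eqP h1 /eqP h2 [gb /(congr1 val)].
  rewrite /= !inordK ?ltn_mod// => gm.
  have : absZ k1 = absZ k2.
    by rewrite (divn_eq (absZ k1) 8) (divn_eq (absZ k2) 8) gm -!phiE h1 h2.
  move=> ab; apply/val_inj; move: gb ab; rewrite /absZ /=.
  have k1N : (k1 < N)%N by exact: ltn_ord.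
  have k2N : (k2 < N)%N by exact: ltn_ord.
  by case: leqP => _; case: leqP => _ //; lia.
apply: (@leq_trans #|[set k | phi k == j]|).
  by apply: subset_leq_card; apply/fintype.subsetP => k; rewrite !inE.
rewrite -(card_in_imset ginj); apply: leq_trans (max_card _) _.
by rewrite card_prod card_bool card_ord.
Qed.

Lemma sum_absZ_le (f : nat -> R) : (forall a, 0 <= f a) ->
  \sum_(k : 'Z_N) f (absZ k) <= 2 * \sum_(a < N.+1) f a.
Proof.
move=> f0; apply: (@le_trans _ _ (\sum_(k : 'Z_N) (f k + f (N - k)%N))).
  apply: ler_sum => k _; rewrite /absZ.
  by case: (leqP k (N - k)) => _; rewrite ?lerDl ?lerDr.
rewrite big_split/= mulr_natl mulr2n lerD//.
  by rewrite [leRHS]big_ord_recr/= lerDl.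
rewrite [leRHS]big_ord_recl/= -[leLHS]add0r lerD//.
rewrite (reindex_inj rev_ord_inj)/= le_eqVlt; apply/orP; left; apply/eqP.
by apply: eq_bigr => k _; rewrite subKn.
Qed.

Lemma sum_inv_sqr_le (m : nat) :
  \sum_(a < m.+1) ((a.+1)%:R ^+ 2)^-1 <= 2 - (m.+1)%:R^-1 :> R.
Proof.
elim: m => [|m IH]; first by rewrite big_ord_recl big_ord0 expr1n invr1; lra.
rewrite big_ord_recr/=; apply: le_trans (lerD IH (lexx _)) _.
have m0 : 0 < m.+1%:R :> R by rewrite ltr0n.
rewrite -[m.+2%:R]natr1; move: (m.+1%:R : R) m0 => x x0.
rewrite -subr_ge0 (_ : _ - _ = (x * (x + 1) ^+ 2)^-1).
  by rewrite invr_ge0 mulr_ge0 ?sqr_ge0 ?ltW.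
by field; rewrite !lt0r_neq0//; lra.
Qed.

Lemma theta_nonincreasing s u : s <= u -> theta u <= theta s.
Proof.
move=> su; apply: ler_sum => k _; rewrite ler_expR !mulNr lerN2.
by rewrite ler_wpM2l// rate_ge0.
Qed.

Lemma theta_ge0 s : 0 <= theta s.
Proof. by apply: sumr_ge0 => k _; exact: expR_ge0. Qed.

Lemma theta'_ge0 s : 0 <= theta' s.
Proof.
by apply: sumr_ge0 => k _; rewrite mulr_ge0 ?expR_ge0 ?rate_ge0.
Qed.

Lemma theta'_nonincreasing s u : s <= u -> theta' u <= theta' s.
Proof.
move=> su; apply: ler_sum => k _; rewrite ler_wpM2l ?rate_ge0//.
by rewrite ler_expR !mulNr lerN2 ler_wpM2l// rate_ge0.
Qed.

Lemma expR_div8_le k s : 0 <= s ->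
  expR (- cosrate k * (s / 4)) <= expR (- rate_nat (absZ k %/ 8) * s).
Proof.
move=> s0; rewrite ler_expR !mulNr lerN2 rate_natE.
have := ler_wpM2r s0 (@rate_nat_div8 R n _ (absZ_le k)); lra.
Qed.

(** By [rate_nat_div8], the term at distance a and a quarter of the time is at most the term at
    distance a / 8 and the full time; the frequencies are then regrouped. *)
Lemma theta_quarter s : 0 <= s -> theta (s / 4) <= 16 * theta s.
Proof.
move=> s0; pose f a := expR (- rate_nat a * s).
apply: (@le_trans _ _ (\sum_(k : 'Z_N) f (absZ k %/ 8)%N)).
  by apply: ler_sum => k _; exact: expR_div8_le.
apply: le_trans (sum_div8_le _) _ => [a|]; first exact: expR_ge0.
by rewrite ler_pM2l// /theta; apply: ler_sum => k _; rewrite /f -rate_natE.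
Qed.

Definition theta'_const : R := 32 * ((128 * 128) * expR 64).

(** As in [theta_quarter], but the rates in front must be compared too: replacing distance a by i
    with a <= 16 i costs 32 * 256 * 2 = 128 * 128. *)
Lemma theta'_quarter s : 0 <= s -> s <= 2 * N%:R ^+ 2 ->
  theta' (s / 4) <= theta'_const * theta' s.
Proof.
move=> s0 sN; pose F a := rate_nat a * expR (- rate_nat a * s).
have F0 a : 0 <= F a by rewrite mulr_ge0 ?rate_nat_ge0 ?expR_ge0.
(* Distances below 8 have quotient 0, where [F] vanishes, and are charged to distance 1; this costs
   exp 64, as the gap times 2 N^2 is at most 64. *)
pose f a := F a + (a == 0)%:R * F 1%N.
have f0 a : 0 <= f a by rewrite addr_ge0// mulr_ge0.
set c := (128 * 128) * expR 64 : R.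
have e1 : 1 <= expR 64 :> R by rewrite -expR0 ler_expR.
have c0 : 0 <= c by rewrite mulr_ge0// expR_ge0.
have bound k : cosrate k * expR (- cosrate k * (s / 4)) <= c * f (absZ k %/ 8)%N.
  set a := absZ k; set j := (a %/ 8)%N.
  have aN := absZ_le k; rewrite -/a in aN.
  have rk : cosrate k <= 32 * a%:R ^+ 2 / N%:R ^+ 2 by rewrite rate_natE rate_nat_le.
  have main i : (2 * i <= N)%N -> (a <= 16 * i)%N ->
      cosrate k <= (128 * 128) * rate_nat i.
    move=> iN ai; apply: le_trans rk _.
    have := @rate_nat_ge R n i iN; rewrite invfM.
    have : a%:R ^+ 2 <= 256 * i%:R ^+ 2 :> R.
      by rewrite -!natrX -natrM ler_nat; nia.
    have : 0 <= N%:R ^- 2 :> R by rewrite invr_ge0 exprn_ge0.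
    set q := (_ ^- 2); set x := (a%:R ^+ 2); set z := (i%:R ^+ 2).
    move=> q0 xz zq; have := ler_wpM2r q0 xz; lra.
  have [j0|j0] := posnP j.
    rewrite /f j0 eqxx mul1r.
    apply: (@le_trans _ _ (c * F 1%N)); last by rewrite ler_wpM2l// lerDr.
    rewrite [leRHS](_ : _ = (128 * 128) * rate_nat 1 *
        (expR 64 * expR (- rate_nat 1 * s))); last by rewrite /c /F; ring.
    apply: ler_pM; rewrite ?rate_ge0 ?expR_ge0//.
      by apply: main; lia.
    rewrite -expRD ler_expR; have := ler_wpM2l (ltW gap_gt0) sN.
    have := gap_le; have := mulr_ge0 (rate_ge0 k) s0.
    by move=> ? ? ?; lra.
  apply: (@le_trans _ _ (c * F j)); last by rewrite ler_wpM2l// lerDl mulr_ge0.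
  rewrite /F mulrA; apply: ler_pM; rewrite ?rate_ge0 ?expR_ge0//.
    apply: (@le_trans _ _ ((128 * 128) * rate_nat j)); first by apply: main; lia.
    by rewrite ler_wpM2r ?rate_nat_ge0// /c; lra.
  exact: expR_div8_le.
apply: le_trans (ler_sum _ (fun k _ => bound k)) _.
rewrite -mulr_sumr [leRHS](_ : _ = c * (32 * theta' s)); last first.
  by rewrite /theta'_const -/c; ring.
rewrite ler_wpM2l//.
apply: le_trans (sum_div8_le f0) _.
rewrite big_split/=.
have -> : \sum_(k : 'Z_N) F (absZ k) = theta' s.
  by apply: eq_bigr => k _; rewrite rate_natE.
have F1 : F 1%N <= theta' s.
  rewrite /theta' (bigD1 1)//= rate1 lerDl sumr_ge0// => k _.
  by rewrite mulr_ge0 ?rate_ge0 ?expR_ge0.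
have : \sum_(k : 'Z_N) (absZ k == 0)%:R * F 1%N <= F 1%N.
  rewrite (bigD1 0)//= big1 ?addr0; last first.
    move=> k k0; rewrite gtn_eqF ?mul0r//.
    by rewrite /absZ leq_min subn_gt0 ltn_ord andbT lt0n.
  by rewrite ler_piMl// lern1 leq_b1.
by move=> ?; lra.
Qed.

(** At time N^2 the term at distance a is at most 1 / (1 + a^2 / 2) <= 4 / (a + 1)^2, whose sum is
    bounded uniformly in N. *)
Lemma theta_diffusive : theta (N%:R ^+ 2) <= 16.
Proof.
pose f (a : nat) : R := 4 * ((a.+1)%:R ^+ 2)^-1.
have f0 a : 0 <= f a by rewrite mulr_ge0// invr_ge0 sqr_ge0.
apply: (@le_trans _ _ (\sum_(k : 'Z_N) f (absZ k))).
  apply: ler_sum => k _; rewrite rate_natE mulNr expRN /f.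
  have x0 := @rate_nat_ge R n _ (absZ_le k).
  have N0 : 0 < N%:R ^+ 2 :> R by rewrite exprn_gt0 ?ltr0n.
  have := ler_wpM2r (ltW N0) x0.
  rewrite (_ : _ / _ * _ = (absZ k)%:R ^+ 2 / 2); last first.
    by field; rewrite lt0r_neq0// -natr1; have : 0 <= n.+2%:R :> R by []; lra.
  move=> xx; have := expR_ge1Dx (rate_nat (absZ k) * N%:R ^+ 2).
  set e := expR _ => ee.
  have e0 : 0 < e by exact: expR_gt0.
  rewrite -[(absZ k).+1%:R]natr1 -div1r ler_pdivrMr// mulrAC ler_pdivlMr; last first.
    by rewrite exprn_gt0//; have : 0 <= (absZ k)%:R :> R by []; lra.
  have := sqr_ge0 ((absZ k)%:R - 1 : R).
  move: (rate_nat _ * _) xx ee => w; rewrite !expr2; lra.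
apply: le_trans (sum_absZ_le f0) _.
rewrite /f -mulr_sumr.
have S2 : \sum_(a < N.+1) ((a.+1)%:R ^+ 2)^-1 <= 2 - (N.+1)%:R^-1 :> R.
  exact: sum_inv_sqr_le.
have : 0 <= N.+1%:R^-1 :> R by rewrite invr_ge0.
by move: (_^-1) (\sum_(_ < _) _) S2 => x S S2 x0; lra.
Qed.

(** Half of the exponential absorbs the rate and gives 2 / N^2, at most 4 times the gap; the
    remaining [theta] at time N^2 / 2 is at most 16 * 16. *)
Lemma theta'_diffusive : theta' (N%:R ^+ 2) <= (32 * 32) * rate_nat 1.
Proof.
have N0 : 0 < N%:R ^+ 2 :> R by rewrite exprn_gt0 ?ltr0n.
apply: (@le_trans _ _ (2 / N%:R ^+ 2 * theta (N%:R ^+ 2 / 2))).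
  rewrite mulr_sumr; apply: ler_sum => k _.
  rewrite (_ : - cosrate k * N%:R ^+ 2 =
      - cosrate k * (N%:R ^+ 2 / 2) + - (cosrate k * (N%:R ^+ 2 / 2))); last by field.
  rewrite expRD mulrCA [leRHS]mulrC ler_wpM2l ?expR_ge0//.
  rewrite expRN ler_pdivrMr ?expR_gt0// -ler_pdivrMl ?divr_gt0//.
  apply: le_trans (expR_ge1Dx _); rewrite invf_div mulrC.
  by rewrite lerDr ler01.
have : theta (N%:R ^+ 2 / 2) <= 256.
  apply: (@le_trans _ _ (theta (N%:R ^+ 2 / 4))).
    by apply: theta_nonincreasing; lra.
  have := theta_quarter (ltW N0); have := theta_diffusive; lra.
have q0 : 0 <= 2 / N%:R ^+ 2 :> R by rewrite divr_ge0// ltW.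
move=> /(ler_wpM2l q0) /le_trans; apply.
by have := gap_ge; move: (_ ^- 2) => q; lra.
Qed.

End theta_sums.

(** * Heat kernel bounds on the torus *)

Section torus_heat.
Context {R : realType} (d n : nat) (d0 : (0 < d)%N).
Local Notation N := n.+3.
Implicit Types (k : torus d N) (t s : R).

Definition freq_rate k : R := \sum_i cosrate (k i).
(** Normalized so that the weighted rates sum to 1, as [freq_weight_sum] shows. *)
Definition freq_weight : R := (d%:R * N%:R ^+ d)^-1.

Let NR0 : 0 < N%:R :> R. Proof. by rewrite ltr0n. Qed.
Let dR0 : 0 < d%:R :> R. Proof. by rewrite ltr0n. Qed.

Lemma freq_rate_ge0 k : 0 <= freq_rate k.
Proof. by apply: sumr_ge0 => i _; exact: rate_ge0. Qed.

Lemma freq_rate_le k : freq_rate k <= 2 * d%:R.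
Proof.
apply: (@le_trans _ _ (\sum_(i < d) 2)).
  by apply: ler_sum => i _; exact: rate_le2.
by rewrite sumr_const card_ord mulr_natr.
Qed.

Lemma freq_weight_gt0 : 0 < freq_weight.
Proof. by rewrite invr_gt0 mulr_gt0 ?exprn_gt0. Qed.

Lemma card_torus : #|{: torus d N}| = (N ^ d)%N.
Proof. by rewrite card_ffun !card_ord. Qed.

Lemma freq_weight_card : freq_weight * #|{: torus d N}|%:R <= 1.
Proof.
rewrite card_torus natrX /freq_weight invfM -mulrA mulVf ?mulr1; last first.
  by rewrite expf_neq0// lt0r_neq0.
by rewrite invf_le1// ler1n.
Qed.

Lemma freq_gap k : freq_rate k = 0 \/ rate_nat n 1 <= freq_rate k.
Proof.
have [/existsP[i ki]|/existsPn kz] := boolP [exists i, k i != 0].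
  right; rewrite /freq_rate (bigD1 i)//=; apply: le_trans (@rate_gap R n _ ki) _.
  by rewrite lerDl sumr_ge0// => j _; exact: rate_ge0.
left; rewrite /freq_rate big1// => i _.
by have /negPn/eqP -> := kz i; rewrite rate0.
Qed.

(** Split the rate over the coordinates: the exponential factorizes, the selected coordinate gives
    [theta'] and each of the others [theta]. *)
Lemma sum_freq_prod t :
  \sum_k freq_rate k * expR (- freq_rate k * t) =
  d%:R * (theta' n t * theta n t ^+ d.-1).
Proof.
under eq_bigr do rewrite {1}/freq_rate mulr_suml.
rewrite exchange_big/= mulr_natl -[in RHS](card_ord d) -sumr_const.
apply: eq_bigr => i _.
pose F (j : 'I_d) (a : 'Z_N) :=
  (if j == i then cosrate a else 1) * expR (- cosrate a * t) : R.
transitivity (\prod_j \sum_a F j a).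
  rewrite bigA_distr_bigA/=; apply: eq_bigr => k _.
  rewrite /F big_split/= (bigD1 i)//= eqxx big1 ?mulr1; last first.
    by move=> j /negPf ->.
  by rewrite -expR_sum mulNr mulr_suml -sumrN; under eq_bigr do rewrite -mulNr.
rewrite (bigD1 i)//=; congr (_ * _).
  by apply: eq_bigr => a _; rewrite /F eqxx.
rewrite (eq_bigr (fun=> theta n t)); last first.
  move=> j /negPf ji; apply: eq_bigr => a _.
  by rewrite /F ji mul1r.
by rewrite prodr_const cardC1 card_ord.
Qed.

Local Notation torus_heat := (heat freq_rate freq_weight).

Lemma heat_prod t :
  torus_heat t = N%:R ^- d * (theta' n (2 * t) * theta n (2 * t) ^+ d.-1).
Proof.
rewrite /heat; under eq_bigr do rewrite mulNr [2 * _]mulrC -mulrA -mulNr.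
rewrite sum_freq_prod /freq_weight.
by field; rewrite expf_neq0 ?lt0r_neq0.
Qed.

(** At time 0 both theta sums equal N, for [theta'] because the cosines [cosmode k 1] sum to 0. *)
Lemma freq_weight_sum : freq_weight * \sum_k freq_rate k = 1.
Proof.
have := sum_freq_prod 0.
under eq_bigr do rewrite mulr0 expR0 mulr1; move=> ->.
have -> : theta n 0 = N%:R :> R.
  rewrite /theta; under eq_bigr do rewrite mulr0 expR0.
  by rewrite sumr_const card_ord.
have -> : theta' n 0 = N%:R :> R.
  rewrite /theta'; under eq_bigr do rewrite mulr0 expR0 mulr1.
  have := @sum_cosmode R n 1; rewrite mul0r => S1.
  rewrite /cosrate sumrB sumr_const card_ord.
  by rewrite S1 subr0.
by rewrite -exprS prednK// /freq_weight mulVf ?mulf_neq0 ?lt0r_neq0 ?exprn_gt0.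
Qed.

Lemma torus_heat_half t : 0 <= t -> t <= N%:R ^+ 2 ->
  torus_heat (t / 2) <= (theta'_const * 16 ^+ d.-1) * torus_heat t.
Proof.
move=> t0 tN; rewrite !heat_prod [leRHS]mulrCA ler_wpM2l ?invr_ge0 ?exprn_ge0//.
have t20 : 0 <= 2 * t by rewrite mulr_ge0.
rewrite (_ : theta'_const * _ * _ = (theta'_const * theta' n (2 * t)) *
  (16 * theta n (2 * t)) ^+ d.-1); last by rewrite exprMn; ring.
have -> : 2 * (t / 2) = t by field.
apply: ler_pM; rewrite ?theta'_ge0 ?exprn_ge0 ?theta_ge0//.
  apply: (@le_trans _ _ (theta' n (2 * t / 4))).
    by apply: theta'_nonincreasing; lra.
  by apply: theta'_quarter => //; lra.
rewrite lerXn2r ?nnegrE ?mulr_ge0 ?theta_ge0//.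
apply: (@le_trans _ _ (theta n (2 * t / 4))).
  by apply: theta_nonincreasing; lra.
exact: theta_quarter.
Qed.

Lemma heat_gap_decay s t : s <= t ->
  torus_heat t <= torus_heat s * expR (- (2 * rate_nat n 1) * (t - s)).
Proof.
move=> st; rewrite /heat -mulrA ler_pM2l ?freq_weight_gt0// mulr_suml.
apply: ler_sum => k _; have [->|lk] := freq_gap k; first by rewrite !mul0r.
rewrite -mulrA ler_wpM2l ?freq_rate_ge0// -expRD ler_expR.
have ts : 0 <= t - s by rewrite subr_ge0.
by have := ler_wpM2r ts lk; lra.
Qed.

(** The bounds on [theta'] and [theta] at time N^2, times exp 32, which pays for starting the gap
    decay at time N^2 / 2. *)
Definition diffusive_const : R := (32 * 32) * 16 ^+ d.-1 * expR 32.

Lemma torus_heat_le t : N%:R ^+ 2 / 2 <= t ->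
  torus_heat t <= diffusive_const * rate_nat n 1 / N%:R ^+ d *
            expR (- (2 * rate_nat n 1) * t).
Proof.
move=> Nt; apply: le_trans (heat_gap_decay Nt) _.
rewrite (_ : - (2 * rate_nat n 1) * (t - N%:R ^+ 2 / 2) =
  rate_nat n 1 * N%:R ^+ 2 + - (2 * rate_nat n 1) * t); last by field.
rewrite expRD mulrA ler_wpM2r ?expR_ge0//.
rewrite (_ : diffusive_const * _ / _ = N%:R ^- d *
  (((32 * 32) * rate_nat n 1) * 16 ^+ d.-1) * expR 32); last first.
  by rewrite /diffusive_const; ring.
apply: ler_pM; rewrite ?expR_ge0 ?ler_expR ?gap_le//.
  by rewrite mulr_ge0 ?(ltW freq_weight_gt0)// sumr_ge0// => k _;
    rewrite mulr_ge0 ?freq_rate_ge0 ?expR_ge0.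
rewrite heat_prod ler_wpM2l ?invr_ge0 ?exprn_ge0//.
rewrite (_ : 2 * (N%:R ^+ 2 / 2) = N%:R ^+ 2); last by field.
apply: ler_pM; rewrite ?theta'_ge0 ?exprn_ge0 ?theta_ge0 ?theta'_diffusive//.
by rewrite lerXn2r ?nnegrE ?theta_ge0 ?theta_diffusive.
Qed.

(** Keep only the frequency [k0] with a single nonzero coordinate, equal to 1: its rate is the
    gap. *)
Lemma torus_heat_ge t :
  diffusive_const * rate_nat n 1 / N%:R ^+ d * expR (- (2 * rate_nat n 1) * t)
  <= (diffusive_const * d%:R) * torus_heat t.
Proof.
have D0 : 0 < diffusive_const by rewrite !mulr_gt0 ?exprn_gt0 ?expR_gt0.
move: diffusive_const D0 => D D0; rewrite -!mulrA ler_pM2l//.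
pose k0 : torus d N := [ffun i => if i == Ordinal d0 then 1 else 0].
have k0E : freq_rate k0 = rate_nat n 1.
  rewrite /freq_rate (bigD1 (Ordinal d0))//= ffunE eqxx rate1 big1 ?addr0//.
  by move=> i /negPf ii; rewrite ffunE ii rate0.
have : freq_weight * (rate_nat n 1 * expR (- (2 * rate_nat n 1) * t)) <= torus_heat t.
  rewrite ler_pM2l ?freq_weight_gt0// (bigD1 k0)//= k0E lerDl sumr_ge0// => k _.
  by rewrite mulr_ge0 ?freq_rate_ge0 ?expR_ge0.
move=> /(ler_wpM2l (ltW dR0)) /(le_trans _); apply.
rewrite le_eqVlt; apply/orP; left; apply/eqP; rewrite /freq_weight.
by field; rewrite expf_neq0 ?lt0r_neq0.
Qed.

(** The gap is of order N^-2; this is the source of N^(d+2) in the exponential correction. *)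
Lemma gap_scale : rate_nat n 1 / N%:R ^+ d <= 32 / N%:R ^+ (d + 2) :> R.
Proof.
rewrite exprD invfM mulrA [32 / _]mulrC [leLHS]mulrC -mulrA.
rewrite ler_wpM2l ?invr_ge0 ?exprn_ge0//.
by rewrite ler_pdivlMr ?exprn_gt0// gap_le.
Qed.

End torus_heat.

(** * Modes and quadratic forms on the torus *)

Section torus_neighbors.
Context {d n : nat}.
Local Notation N := n.+3.
Local Notation T := (torus d N).
Implicit Types (x y z : T).

Definition unit_vec (i : 'I_d) : T := [ffun j => (j == i)%:R].

Lemma absZ_eq0 (a : 'Z_N) : (absZ a == 0%N) = (a == 0).
Proof.
have aN : (a < N)%N by exact: ltn_ord.
rewrite -val_eqE/= /absZ; lia.
Qed.

Lemma absZN (a : 'Z_N) : absZ (- a) = absZ a.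
Proof.
have aN : (a < N)%N by exact: ltn_ord.
have [->|a0] := eqVneq a 0; first by rewrite oppr0.
have {}a0 : (0 < a)%N by rewrite lt0n.
have aE : nat_of_ord (- a) = (N - a)%N by apply: modn_small; rewrite ltn_subrL a0.
by rewrite /absZ aE; lia.
Qed.

Lemma val_ZpN1 : nat_of_ord (- 1 : 'Z_N) = (N - 1)%N.
Proof. by apply: modn_small; rewrite ltn_subrL. Qed.

Lemma absZ_eq1 (a : 'Z_N) : (absZ a == 1%N) = (a == 1) || (a == - 1).
Proof.
have aN : (a < N)%N by exact: ltn_ord.
have -> : (a == - 1) = (nat_of_ord a == N - 1)%N by rewrite -val_ZpN1.
have -> : (a == 1) = (nat_of_ord a == 1)%N by [].
by rewrite /absZ; lia.
Qed.

Lemma torus_distE x y : torus_dist x y = (\sum_i absZ ((x - y)%R i))%N.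
Proof. by apply: eq_bigr => i _; rewrite !ffunE. Qed.

Lemma torus_distC x y : torus_dist x y = torus_dist y x.
Proof.
by rewrite !torus_distE; apply: eq_bigr => i _; rewrite -absZN !ffunE opprB.
Qed.

Definition step (x : T) (p : 'I_d * bool) : T :=
  if p.2 then x + unit_vec p.1 else x - unit_vec p.1.

(** Rests on 1 <> -1 in Z/NZ, that is on N >= 3; it makes the 2 d neighbors distinct in
    [sum_neighbors]. *)
Lemma step_inj x : injective (step x).
Proof.
have one : (1 : 'Z_N) != - 1.
  by apply/eqP => /(congr1 (@nat_of_ord _)); rewrite val_ZpN1.
have mone : - 1 != 0 :> 'Z_N by rewrite oppr_eq0 oner_eq0.
move=> [i b] [j c] /ffunP /(_ i); rewrite /step.
have [->|ij] := eqVneq i j.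
  case: b c => -[]; rewrite //= !ffunE eqxx => /addrI/eqP;
  by rewrite ?(negbTE one) // eq_sym (negbTE one).
case: b c => -[]; rewrite /= !ffunE eqxx (negbTE ij) ?oppr0 => /addrI/eqP;
  by rewrite ?(negbTE mone) ?oner_eq0.
Qed.

Lemma torus_dist1 x y :
  (torus_dist x y == 1%N) = (y \in [set step x p | p : 'I_d * bool]).
Proof.
rewrite torus_distC torus_distE; apply/idP/imsetP.
  move=> /sum_nat_eq1[i [_ /eqP i1 z0]].
  exists (i, (y - x) i == 1) => //; rewrite /step /=.
  rewrite -{1}[y](subrK x) addrC.
  case: ifPn => yi; congr (x + _); apply/ffunP => j.
    have [->|ji] := eqVneq j i; first by rewrite (eqP yi) ffunE eqxx.
    by rewrite [RHS]ffunE (negPf ji); apply/eqP; rewrite -absZ_eq0 z0.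
  rewrite [in RHS]ffunE [in RHS]ffunE.
  have [->|ji] := eqVneq j i.
    by move: i1; rewrite absZ_eq1 (negPf yi) => /eqP.
  by rewrite oppr0; apply/eqP; rewrite -absZ_eq0 z0.
move=> [[i b] _ ->].
have zj (j : 'I_d) : absZ ((step x (i, b) - x) j) = (j == i).
  rewrite /step; case: b => /=; rewrite [x + _]addrC addrK !ffunE.
    by case: eqP.
  by rewrite absZN; case: eqP.
apply/sum_nat_eq1; exists i; split=> // [|j /negPf ji _]; first by rewrite zj eqxx.
by rewrite zj ji.
Qed.

Lemma sum_neighbors (V : nmodType) (F : T -> V) x :
  \sum_(y | torus_dist x y == 1%N) F y =
  \sum_i (F (x + unit_vec i) + F (x - unit_vec i)).
Proof.
under eq_bigl do rewrite torus_dist1.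
rewrite big_imset/=; last by move=> p q _ _; exact: step_inj.
rewrite (eq_bigl predT)//.
rewrite -(pair_bigA _ (fun i b => F (step x (i, b))))/=.
by apply: eq_bigr => i _; rewrite big_bool.
Qed.

End torus_neighbors.

(** * Laplacian of the walk and summation by parts *)

Section laplacian.
Context {R : realType} {d n : nat}.
Local Notation N := n.+3.
Local Notation T := (torus d N).
Implicit Types (x y z : T) (f g : T -> R).

Definition lap f x : R := 2^-1 * \sum_(y | torus_dist x y == 1%N) (f y - f x).

Lemma lapE f x : lap f x =
  2^-1 * \sum_i (f (x + unit_vec i) + f (x - unit_vec i) - 2 * f x).
Proof.
rewrite /lap sum_neighbors; congr (_ * _); apply: eq_bigr => i _.
by ring.
Qed.

Lemma lap_translate f y x : lap (fun z => f (z - y)) x = lap f (x - y).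
Proof.
rewrite !lapE; congr (_ * _); apply: eq_bigr => i _.
by rewrite ![x - y + _]addrAC.
Qed.

Lemma lap_sum (I : finType) (c : I -> R) (f : I -> T -> R) x :
  lap (fun z => \sum_i c i * f i z) x = \sum_i c i * lap (f i) x.
Proof.
rewrite /lap; under [RHS]eq_bigr do rewrite mulrCA.
rewrite -mulr_sumr; congr (_ * _); under [RHS]eq_bigr do rewrite mulr_sumr.
rewrite exchange_big/=; apply: eq_bigr => y _.
by rewrite -sumrB; apply: eq_bigr => i _; rewrite mulrBr.
Qed.

(** Exchanging the endpoints of each edge symmetrizes the sum. *)
Lemma green f g :
  \sum_x \sum_(y | torus_dist x y == 1%N) (f x - f y) * (g x - g y) =
  - (4 * \sum_x f x * lap g x).
Proof.
pose S := \sum_x \sum_(y | torus_dist x y == 1%N) f x * (g x - g y).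
have S2 : S = \sum_x \sum_(y | torus_dist x y == 1%N) f y * (g y - g x).
  rewrite /S (exchange_big_dep xpredT)//=; apply: eq_bigr => y _.
  by apply: eq_bigl => x; rewrite torus_distC.
transitivity (S + S).
  rewrite {2}S2 /S -big_split/=; apply: eq_bigr => x _.
  by rewrite -big_split/=; apply: eq_bigr => y _; ring.
have -> : S = - (2 * \sum_x f x * lap g x).
  rewrite mulr_sumr -sumrN; apply: eq_bigr => x _.
  rewrite -mulr_sumr /lap mulrCA [2 * (_ * _)]mulrA mulfV ?pnatr_eq0// mul1r.
  by rewrite -mulrN -sumrN; congr (_ * _); apply: eq_bigr => y _; rewrite opprB.
by ring.
Qed.

End laplacian.

(** * Rotation-averaged Fourier modes and the closed equation for their quadratic forms *)

Section torus_modes.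
Context {R : realType} {d n : nat}.
Local Notation N := n.+3.
Local Notation T := (torus d.+1 N).
Local Notation rate := (@freq_rate R d.+1 n).
Implicit Types (x y z k : T) (m f g : T -> R).

Definition cosprod k z : R := \prod_i cosmode (k i) (z i).

Lemma cosprodN k z : cosprod k (- z) = cosprod k z.
Proof. by apply: eq_bigr => i _; rewrite !ffunE cosmodeN. Qed.

Lemma cosprod0 k : cosprod k 0 = 1.
Proof. by rewrite /cosprod big1// => i _; rewrite ffunE cosmode0. Qed.

Lemma cosprod_step k z (i : 'I_d.+1) :
  cosprod k (z + unit_vec i) + cosprod k (z - unit_vec i) =
  2 * cosmode (k i) 1 * cosprod k z.
Proof.
have D w : cosprod k w = cosmode (k i) (w i) *
    \prod_(j | j != i) cosmode (k j) (w j) by rewrite /cosprod (bigD1 i).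
rewrite !D !ffunE eqxx {D}.
have E (w : T) : (forall j, j != i -> w j = z j) ->
    \prod_(j | j != i) cosmode (k j) (w j) =
    \prod_(j | j != i) cosmode (k j) (z j) :> R.
  by move=> wz; apply: eq_bigr => j ji; rewrite wz.
rewrite !E; last 2 first.
- by move=> j /negPf ji; rewrite !ffunE ji subr0.
- by move=> j /negPf ji; rewrite !ffunE ji addr0.
by rewrite -mulrDl cosmodeD1; ring.
Qed.

Lemma cosprod_unit k (i : 'I_d.+1) : cosprod k (unit_vec i) = cosmode (k i) 1.
Proof.
have := cosprod_step k 0 i; rewrite add0r sub0r cosprodN cosprod0.
by move=> ?; lra.
Qed.

Lemma lap_cosprod k z : lap (cosprod k) z = - rate k * cosprod k z.
Proof.
rewrite lapE mulr_sumr mulNr mulr_suml -sumrN; apply: eq_bigr => i _.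
by rewrite cosprod_step /cosrate; field.
Qed.

Lemma cosprod_le1 k z : cosprod k z <= 1.
Proof.
apply: le_trans (ler_norm _) _; rewrite normr_prod prodr_ile1// => i.
by rewrite normr_ge0 ler_norml cos_geN1 cos_le1.
Qed.

Lemma sum_cosprod z : \sum_k cosprod k z = (z == 0)%:R * N%:R ^+ d.+1.
Proof.
rewrite /cosprod -(bigA_distr_bigA (fun i a => cosmode a (z i)))/=.
under eq_bigr do rewrite sum_cosmode.
rewrite big_split/= prodr_const card_ord; congr (_ * _).
have [->|z0] := eqVneq z 0; first by rewrite big1// => i _; rewrite ffunE eqxx.
have [/existsP[i zi]|/existsPn zz] := boolP [exists i, z i != 0].
  by rewrite (bigD1 i)//= (negPf zi) mul0r.
by move: z0 => /eqP[]; apply/ffunP => i; rewrite ffunE; have /negPn/eqP := zz i.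
Qed.

Definition rotate (j : 'I_d.+1) k : T := [ffun i => k (i + j)].

Lemma rotate_inj j : injective (rotate j).
Proof.
move=> k l /ffunP kl; apply/ffunP => i; have := kl (i - j).
by rewrite !ffunE subrK.
Qed.

Lemma rate_rotate j k : rate (rotate j k) = rate k.
Proof.
rewrite /freq_rate [RHS](reindex_inj (addIr j))/=.
by apply: eq_bigr => i _; rewrite ffunE.
Qed.

(* Averaging over rotations of the coordinates makes the mode take the same
   value at every unit vector, which makes [quad_generator] a closed equation. *)
Definition mode k z : R := (d.+1)%:R^-1 * \sum_j cosprod (rotate j k) z.

Let d0 : (d.+1)%:R != 0 :> R. Proof. by rewrite pnatr_eq0. Qed.

Lemma modeN k z : mode k (- z) = mode k z.
Proof. by congr (_ * _); apply: eq_bigr => j _; rewrite cosprodN. Qed.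

Lemma mode_const (c : R) (F : 'I_d.+1 -> R) : (forall j, F j = c) ->
  (d.+1)%:R^-1 * \sum_j F j = c.
Proof.
move=> Fc; rewrite (eq_bigr (fun=> c))//.
by rewrite sumr_const card_ord -[c *+ _]mulr_natl mulrA mulVf// mul1r.
Qed.

Lemma mode0 k : mode k 0 = 1.
Proof. by apply: mode_const => j; rewrite cosprod0. Qed.

Lemma mode_unit k (i : 'I_d.+1) : mode k (unit_vec i) = 1 - rate k / (d.+1)%:R.
Proof.
rewrite /mode; under eq_bigr do rewrite cosprod_unit ffunE.
have -> : rate k = \sum_j (1 - cosmode (k (i + j)) 1).
  by rewrite /freq_rate (reindex_inj (addrI i)).
rewrite sumrB sumr_const card_ord.
by move: d0; move: ((d.+1)%:R : R) => D D0; field.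
Qed.

Lemma mode_neighbor k x y : torus_dist x y = 1%N ->
  mode k (y - x) = 1 - rate k / (d.+1)%:R.
Proof.
move=> /eqP; rewrite torus_dist1 => /imsetP[[i b] _ ->]; rewrite /step.
by case: b; rewrite /= addrC addKr ?modeN mode_unit.
Qed.

Lemma mode_le1 k z : mode k z <= 1.
Proof.
rewrite ler_pdivrMl ?ltr0n// mulr1.
apply: (@le_trans _ _ (\sum_(j < d.+1) 1)); last by rewrite sumr_const card_ord.
by apply: ler_sum => j _; exact: cosprod_le1.
Qed.

Lemma lap_mode k z : lap (mode k) z = - rate k * mode k z.
Proof.
rewrite (_ : mode k = fun z => \sum_j (d.+1)%:R^-1 * cosprod (rotate j k) z); last first.
  by apply/funext => w; rewrite /mode mulr_sumr.
rewrite lap_sum mulr_sumr; apply: eq_bigr => j _.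
by rewrite lap_cosprod rate_rotate mulrCA.
Qed.

(** Each rotation permutes the frequencies, so completeness of [cosprod] carries over to the
    average. *)
Lemma sum_mode z : \sum_k mode k z = (z == 0)%:R * N%:R ^+ d.+1.
Proof.
rewrite -mulr_sumr exchange_big/=; apply: mode_const => j.
rewrite -sum_cosprod [RHS](reindex_inj (@rotate_inj j))/=.
by [].
Qed.

(** For a probability mass [m], the mean of [mode k] at the difference of two independent samples of
    [m]. *)
Definition quad k m : R := \sum_(x : T) \sum_(y : T) mode k (y - x) * (m x * m y).

Definition conv k m x : R := \sum_(y : T) m y * mode k (x - y).

Lemma quadE k m : quad k m = \sum_x m x * conv k m x.
Proof.
apply: eq_bigr => x _; rewrite mulr_sumr; apply: eq_bigr => y _.
by rewrite -modeN opprB; ring.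
Qed.

Lemma lap_conv k m x : lap (conv k m) x = - rate k * conv k m x.
Proof.
rewrite lap_sum mulr_sumr; apply: eq_bigr => y _.
by rewrite lap_translate lap_mode mulrCA.
Qed.

Lemma sum_conv m x : \sum_k conv k m x = N%:R ^+ d.+1 * m x.
Proof.
rewrite exchange_big/=; under eq_bigr do rewrite -mulr_sumr sum_mode subr_eq0.
rewrite (bigD1 x)//= eqxx mul1r big1 ?addr0 1?mulrC// => y /negPf yx.
by rewrite eq_sym yx mul0r mulr0.
Qed.

Lemma lap_sum_conv m x : N%:R ^+ d.+1 * lap m x = - \sum_k rate k * conv k m x.
Proof.
rewrite -sumrN; under [RHS]eq_bigr do rewrite -mulNr -lap_conv -[lap _ _]mul1r.
rewrite -lap_sum (_ : (fun z => \sum_k 1 * conv k m z) =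
    fun z => \sum_(i : 'I_1) N%:R ^+ d.+1 * m z); last first.
  apply/funext => z; rewrite big_ord1 -sum_conv.
  by apply: eq_bigr => k _; rewrite mul1r.
by rewrite lap_sum big_ord1.
Qed.

(** A Parseval identity: summation by parts turns the edge sum into [m] against its Laplacian, and
    [lap_sum_conv] expands the Laplacian in modes. *)
Lemma sum_rate_quad m :
  \sum_k rate k * quad k m =
  N%:R ^+ d.+1 / 4 * \sum_x \sum_(y | torus_dist x y == 1%N) (m x - m y) ^+ 2.
Proof.
rewrite [X in _ = _ * X](_ : _ = - (4 * \sum_x m x * lap m x)); last first.
  rewrite -green; apply: eq_bigr => x _; apply: eq_bigr => y _.
  by rewrite expr2.
rewrite mulrN -mulrA (mulrA 4^-1) mulVf ?pnatr_eq0// mul1r mulr_sumr -sumrN.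
under eq_bigr do rewrite quadE mulr_sumr.
rewrite exchange_big/=; apply: eq_bigr => x _.
rewrite mulrCA lap_sum_conv mulrN opprK mulr_sumr.
by apply: eq_bigr => k _; rewrite mulrCA.
Qed.

Lemma dirichlet_quad m :
  dirichlet (fun x => m x / uniform_mass R x) = \sum_k rate k * quad k m.
Proof.
rewrite sum_rate_quad /dirichlet /uniform_mass.
have M0 : N%:R ^+ d.+1 != 0 :> R by rewrite expf_neq0 ?pnatr_eq0.
move: (N%:R ^+ d.+1 : R) M0 => M M0.
rewrite !mulr_sumr; apply: eq_bigr => x _; rewrite !mulr_sumr.
by apply: eq_bigr => y _; field; rewrite ?M0.
Qed.

(** Averaging moves the mass (m x - m y) / 2 from x to y. *)
Lemma sum_average_mass x y m (F : T -> R) : x != y ->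
  \sum_z F z * average_mass x y m z =
  \sum_z F z * m z - (m x - m y) / 2 * (F x - F y).
Proof.
move=> xy; rewrite (bigD1 x)//= (bigD1 y) 1?eq_sym//=.
rewrite [in RHS](bigD1 x)//= [in RHS](bigD1 y) 1?eq_sym//=.
rewrite (eq_bigr (fun z => F z * m z)); last first.
  by move=> z /andP[/negPf zx /negPf zy]; rewrite /average_mass zx zy.
by rewrite /average_mass !eqxx orbT/=; field.
Qed.

(** Expand the quadratic form at [m] minus (m x - m y) / 2 times the difference of the unit masses
    at x and y. The second-order term contains the mode at 0 minus the mode at y - x, which is the
    rate over the dimension for every edge. *)
Lemma quad_average k x y m : torus_dist x y = 1%N ->
  quad k (average_mass x y m) - quad k m =
  - ((m x - m y) * (conv k m x - conv k m y)) +
  (m x - m y) ^+ 2 / 2 * (rate k / (d.+1)%:R).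
Proof.
move=> xy1; have xy : x != y.
  apply/eqP => xy; move: xy1; rewrite xy torus_distE big1// => i _.
  by rewrite subrr ffunE.
have modexy := mode_neighbor k xy1.
set m' := average_mass x y m.
have conv' z : conv k m' z = conv k m z -
    (m x - m y) / 2 * (mode k (z - x) - mode k (z - y)).
  rewrite /conv; under eq_bigr do rewrite mulrC.
  rewrite sum_average_mass//; congr (_ - _).
  by apply: eq_bigr => w _; rewrite mulrC.
have sym : \sum_(z : T) mode k (z - x) * m z = conv k m x.
  by apply: eq_bigr => z _; rewrite -modeN opprB mulrC.
have sym' : \sum_(z : T) mode k (z - y) * m z = conv k m y.
  by apply: eq_bigr => z _; rewrite -modeN opprB mulrC.
rewrite !quadE; under eq_bigr do rewrite mulrC.
rewrite sum_average_mass//.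
have -> : \sum_z conv k m' z * m z = \sum_z m z * conv k m z -
    (m x - m y) / 2 * (conv k m x - conv k m y).
  rewrite -sym -sym' -sumrB mulr_sumr -sumrB.
  by apply: eq_bigr => z _; rewrite conv'; ring.
rewrite !conv' !subrr mode0 modexy -[mode k (x - y)]modeN opprB modexy.
by field.
Qed.

(** Summed over the edges, the first-order terms give the decay by [green] and [lap_conv], and the
    squares give the Dirichlet form, itself a combination of the modes. *)
Lemma quad_generator k m :
  2^-1 * \sum_x \sum_(y | torus_dist x y == 1%N)
    (quad k (average_mass x y m) - quad k m) =
  - (2 * rate k) * quad k m +
  rate k * (freq_weight d.+1 n * \sum_j rate j * quad j m).
Proof.
rewrite sum_rate_quad.
transitivity (2^-1 * (- (\sum_x \sum_(y | torus_dist x y == 1%N)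
    (m x - m y) * (conv k m x - conv k m y)) +
    (rate k / (d.+1)%:R / 2) *
    \sum_x \sum_(y | torus_dist x y == 1%N) (m x - m y) ^+ 2)).
  congr (_ * _).
  rewrite [X in _ + X]mulr_sumr -[X in X + _]sumrN -big_split/=.
  apply: eq_bigr => x _.
  rewrite [X in _ + X]mulr_sumr -[X in X + _]sumrN -big_split/=.
  apply: eq_bigr => y /eqP xy.
  by rewrite quad_average//; ring.
rewrite green quadE.
under eq_bigr do rewrite lap_conv mulrCA.
rewrite -mulr_sumr /freq_weight.
have M0 : N%:R ^+ d.+1 != 0 :> R by rewrite expf_neq0 ?pnatr_eq0.
move: (N%:R ^+ d.+1 : R) M0 => M M0.
move: d0; move: ((d.+1)%:R : R) => D D0.
by field; rewrite M0 D0.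
Qed.

Lemma quad_le1 k m : (forall x, 0 <= m x) -> \sum_x m x = 1 -> quad k m <= 1.
Proof.
move=> m0 m1; apply: (@le_trans _ _ (\sum_x \sum_y m x * m y)).
  apply: ler_sum => x _; apply: ler_sum => y _.
  by rewrite ler_piMl ?mode_le1// mulr_ge0.
by under eq_bigr do rewrite -mulr_sumr m1 mulr1; rewrite m1.
Qed.

Lemma quad_dirac k : quad k (@dirac_mass R d.+1 N 0) = 1.
Proof.
have dE (F : T -> R) : \sum_y F y * dirac_mass R 0 y = F 0.
  rewrite (bigD1 (0 : T))//= big1 ?addr0 /dirac_mass ?eqxx ?mulr1// => y /negPf ->.
  by rewrite mulr0.
rewrite quadE; under eq_bigr do rewrite mulrC.
rewrite dE /conv; under eq_bigr do rewrite mulrC.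
by rewrite dE subrr mode0.
Qed.

End torus_modes.

(** * Feller semigroups and Markov jump processes *)

Section epsilon_derivative.
Context {R : realType}.
Implicit Types (u v : R -> R) (e s t h : R).

Definition halfline_unif_continuous u := forall e, 0 < e -> exists2 del, 0 < del &
  forall s t, 0 <= s -> 0 <= t -> `|s - t| < del -> `|u s - u t| <= e.

Lemma near_right0 (Q : R -> Prop) : (\forall h \near (0 : R)^'+, Q h) ->
  exists2 del, 0 < del & forall h, 0 < h -> h < del -> Q h.
Proof.
rewrite /at_right near_withinE => /nbhs_ballP [del /= del0 H].
exists del => // h h0 hdel; apply: H => //.
by rewrite /ball/= sub0r normrN gtr0_norm.
Qed.

Lemma halfline_unif_continuousW u : halfline_unif_continuous u ->
  {within `[0, +oo[, continuous u}.
Proof.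
move=> cu; apply/continuous_within_itvcyP; split.
  move=> t; rewrite in_itv/= andbT => t0; apply/cvgrPdist_le => e e0.
  have [del del0 H] := cu e e0.
  apply/nbhs_ballP; exists (Num.min del t) => /=; first by rewrite lt_min del0.
  move=> s; rewrite /ball/= lt_min => /andP[sd /ltr_normlW st].
  by apply: H => //; [exact: ltW|lra].
apply/cvgrPdist_le => e e0; have [del del0 H] := cu e e0.
rewrite /at_right near_withinE; apply/nbhs_ballP; exists del => //= s sd s0.
by apply: H => //; exact: ltW.
Qed.

Lemma is_derive_eps u t l :
  (forall e, 0 < e -> exists2 del, 0 < del & forall h, h != 0 -> `|h| < del ->
     `|u (t + h) - u t - h * l| <= e * `|h|) -> is_derive t (1 : R) u l.
Proof.
move=> H; suff cl : (fun h => h^-1 *: ((u \o shift t) (h *: 1) - u t)) @ 0^' --> l.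
  by split; [apply/cvg_ex; exists l|exact/cvg_lim].
apply/cvgrPdist_le => e e0; have [del del0 {}H] := H e e0.
rewrite near_withinE; apply/nbhs_ballP; exists del => //= h.
rewrite /ball/= sub0r normrN => hdel h0.
have := H h h0 hdel; rewrite -ler_pdivrMr ?normr_gt0// -normfV -normrM.
rewrite distrC /GRing.scale/= mulr1 [h + t]addrC.
congr (`|_| <= _); by field.
Qed.

(** For a negative increment h, the right-hand estimate is applied at t + h, and [v (t + h)] is
    replaced by [v t] through uniform continuity. *)
Lemma halfline_derive_right u v : halfline_unif_continuous u ->
  halfline_unif_continuous v ->
  (forall e, 0 < e -> exists2 del, 0 < del & forall t h, 0 <= t -> 0 < h ->
     h < del -> `|u (t + h) - u t - h * v t| <= e * h) ->
  halfline_derive u v.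
Proof.
move=> cu cv H; split; last exact: halfline_unif_continuousW.
move=> t t0; apply: is_derive_eps => e e0.
have e20 : 0 < e / 2 by lra.
have [d1 d10 H1] := H _ e20; have [d2 d20 H2] := cv _ e20.
exists (Num.min t (Num.min d1 d2)); first by rewrite !lt_min t0 d10.
move=> h h0; rewrite !lt_min => /and3P[ht h1 h2].
have [hpos|hneg] := ltP 0 h.
  rewrite gtr0_norm// in ht h1 h2 *.
  by apply: le_trans (H1 t h (ltW t0) hpos h1) _; rewrite ler_pM2r//; lra.
have {hneg}hneg : h < 0 by rewrite lt_neqAle h0.
rewrite ltr0_norm// in ht h1 h2 *.
have th0 : 0 <= t + h by lra.
have hN : 0 < - h by lra.
have := H1 (t + h) (- h) th0 hN h1; rewrite addrK => A.
have B : `|v (t + h) - v t| <= e / 2.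
  by apply: H2 => //; [exact: ltW|rewrite addrAC subrr add0r ltr0_norm].
have {}B : `|(- h) * (v (t + h) - v t)| <= e / 2 * - h.
  by rewrite normrM gtr0_norm// mulrC ler_pM2r.
have := le_trans (ler_normD _ _) (lerD A B).
rewrite -normrN; rewrite [X in `|X|](_ : _ = u (t + h) - u t - h * v t); last by ring.
move=> /le_trans; apply; rewrite le_eqVlt; apply/orP; left; apply/eqP; by field.
Qed.

End epsilon_derivative.

Section real_continuous.
Context {R : realType} {E : topologicalType}.
Implicit Types f g : E -> R.

Lemma continuous_sum (I : Type) (r : seq I) (F : I -> E -> R) :
  (forall i, continuous (F i)) -> continuous (fun y => \sum_(i <- r) F i y).
Proof.
by move=> cF; apply: (continuous_big (P := xpredT) add_continuous) => i _.
Qed.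

Lemma continuous_mul f g : continuous f -> continuous g ->
  continuous (fun y => f y * g y).
Proof. by move=> cf cg y; apply: cvgM; [exact: cf|exact: cg]. Qed.

Lemma continuous_scale a f : continuous f -> continuous (fun y => a * f y).
Proof. by apply: continuous_mul; exact: cst_continuous. Qed.

Lemma continuousZD a f g : continuous f -> continuous g ->
  continuous (fun y => a * f y + g y).
Proof.
move=> cf cg y; apply: cvgD; last exact: cg.
by apply: cvgM; [exact: cvg_cst|exact: cf].
Qed.

End real_continuous.

Section feller.
Context {R : realType} {E : topologicalType}.
Context (S : R -> (E -> R) -> E -> R) (L : (E -> R) -> E -> R).
Context (fS : feller_semigroup S).
Implicit Types (f g : E -> R) (t h e c : R).

Let cst_cont c : continuous (fun _ : E => c) := @cst_continuous _ _ c.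

Lemma fellerZD t a f g : 0 <= t -> continuous f -> continuous g -> forall x,
  S t (fun y => a * f y + g y) x = a * S t f x + S t g x.
Proof. by move=> t0 cf cg x; rewrite (feller_linear fS). Qed.

Lemma feller0 t x : 0 <= t -> S t (fun=> 0) x = 0.
Proof.
move=> t0; have := fellerZD (-1) t0 (@cst_cont 0) (@cst_cont 0) x.
rewrite (_ : (fun=> _) = (fun=> 0)); last by apply/funext => y; ring.
by move=> ->; ring.
Qed.

Lemma feller_sum (I : Type) (r : seq I) (a : I -> R) (F : I -> E -> R) t x :
  0 <= t -> (forall i, continuous (F i)) ->
  S t (fun y => \sum_(i <- r) a i * F i y) x = \sum_(i <- r) a i * S t (F i) x.
Proof.
move=> t0 cF; elim: r => [|i r IH].
  rewrite big_nil -[RHS](feller0 x t0); congr (S t _ x).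
  by apply/funext => y; rewrite big_nil.
rewrite big_cons -IH -fellerZD//.
  by congr (S t _ x); apply/funext => y; rewrite big_cons.
by apply: continuous_sum => j; exact: continuous_scale.
Qed.

Lemma feller_le t f g x : 0 <= t -> continuous f -> continuous g ->
  (forall y, f y <= g y) -> S t f x <= S t g x.
Proof.
move=> t0 cf cg fg; rewrite -subr_ge0.
have := fellerZD (-1) t0 cf cg x; rewrite mulN1r addrC => <-.
apply: (feller_ge0 fS) => //; first exact: continuousZD.
by move=> y; rewrite mulN1r addrC subr_ge0.
Qed.

Lemma feller_cst t c x : 0 <= t -> S t (fun=> c) x = c.
Proof.
move=> t0; have := fellerZD c t0 (@cst_cont 1) (@cst_cont 0) x.
rewrite (feller_one fS t0) feller0// mulr1 addr0 => E1; rewrite -[RHS]E1.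
by congr (S t _ x); apply/funext => y /=; ring.
Qed.

Lemma feller_norm_le t f c x : 0 <= t -> continuous f ->
  (forall y, `|f y| <= c) -> `|S t f x| <= c.
Proof.
move=> t0 cf fc; rewrite ler_norml; apply/andP; split.
  rewrite -(feller_cst (- c) x t0); apply: feller_le => // y.
  by have := fc y; rewrite ler_norml => /andP[].
rewrite -(feller_cst c x t0); apply: feller_le => // y.
by have := fc y; rewrite ler_norml => /andP[].
Qed.

(** By the semigroup property and contraction, the modulus of continuity at time 0 serves at every
    time. *)
Lemma feller_unif_continuous f x : continuous f ->
  halfline_unif_continuous (fun t => S t f x).
Proof.
move=> cf e e0.
have [del del0 H] := near_right0 (feller_cvg fS cf e0).
have key s t : 0 <= s -> 0 <= t -> s <= t -> `|s - t| < del ->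
    `|S s f x - S t f x| <= e.
  move=> s0 t0; rewrite le_eqVlt => /predU1P[->|st] std.
    by rewrite subrr normr0 ltW.
  have ts : 0 < t - s by rewrite subr_gt0.
  rewrite distrC gtr0_norm// in std.
  have -> : S t f x = S s (S (t - s) f) x.
    by rewrite -(feller_add fS)// ?(ltW ts)// addrC subrK.
  have cS : continuous (S (t - s) f) := feller_continuous fS (ltW ts) cf.
  have E1 : S s (S (t - s) f) x - S s f x =
      S s (fun y => -1 * f y + S (t - s) f y) x by rewrite fellerZD//; ring.
  rewrite distrC E1.
  apply: feller_norm_le => // [|y]; first exact: continuousZD.
  by rewrite mulN1r addrC H.
exists del => // s t s0 t0 std; have [st|/ltW ts] := leP s t; first exact: key.
by rewrite distrC key// distrC.
Qed.

(** Write [S (t + h) f = S t (S h f)]: the contraction [S t] transports the uniform limit defining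
    the generator, with an error independent of t. *)
Lemma feller_derive f x : has_generator S L -> continuous f ->
  continuous (L f) ->
  halfline_derive (fun t => S t f x) (fun t => S t (L f) x).
Proof.
move=> gen cf cLf.
apply: halfline_derive_right; [exact: feller_unif_continuous..|].
move=> e e0; have [del del0 H] := near_right0 (gen f cf e e0).
exists del => // t h t0 h0 hdel.
have cS : continuous (S h f) := feller_continuous fS (ltW h0) cf.
rewrite (feller_add fS)// ?(ltW h0)//.
have cB : continuous (fun y => -1 * f y + S h f y) by exact: continuousZD.
have E1 : S t (S h f) x - S t f x - h * S t (L f) x =
    S t (fun y => - h * L f y + (fun y => -1 * f y + S h f y) y) x.
  by rewrite (fellerZD (- h) t0 cLf cB) (fellerZD (-1) t0 cf cS); ring.
rewrite E1; apply: feller_norm_le => // [|y]; first exact: continuousZD.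
apply: le_trans _ (ler_wpM2r (ltW h0) (H h h0 hdel y)).
rewrite -[X in _ <= _ * X](gtr0_norm h0) -normrM.
rewrite [X in _ <= `|X|](_ : _ = - h * L f y + (-1 * f y + S h f y))//.
by field; exact: lt0r_neq0.
Qed.

End feller.

Section markov_expectation.
Context {R : realType} {E : topologicalType} {disp : measure_display}.
Context {Om : measurableType disp} (P : probability Om R).
Context (L : (E -> R) -> E -> R) (x0 : E) (X : R -> Om -> E).

Lemma markov_measurable (f : E -> R) (t : R) : markov_jump_process P L x0 X ->
  0 <= t -> continuous f -> measurable_fun setT (EFin \o (f \o X t)).
Proof.
move=> mX t0 /continuousP cf; apply/measurable_EFinP.
apply: (measurability _ (RGenOpens.measurableE R)) => _ [_ [a [b ->]] <-].
rewrite setTI; apply: (process_measurable mX t0 (cf `]a, b[%classic _)).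
exact: interval_open.
Qed.

(** Use the Markov property at time s = 0 on the whole space, where the process sits almost surely
    at [x0]. *)
Lemma markov_expectation : markov_jump_process P L x0 X ->
  exists S, [/\ feller_semigroup S, has_generator S L &
    forall (t : R) (f : E -> R), 0 <= t -> continuous f ->
      (\int[P]_w (f (X t w))%:E = (S t f x0)%:E)%E].
Proof.
move=> mX; have [S [fS genS markov]] := process_markov mX.
exists S; split=> // t f t0 cf.
have pT : past X 0 setT.
  rewrite /past; set G := [set A | _].
  have [G0 GC _] := smallest_sigma_algebra setT G.
  by have := GC _ G0; rewrite setD0.
have := markov 0 t f setT (lexx 0) t0 cf pT; rewrite add0r => ->.
have cS : continuous (S t f) := feller_continuous fS t0 cf.
rewrite (ae_eq_integral (cst (S t f x0)%:E))//; last first.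
- by apply: filterS (process_start mX) => w /= -> _.
- exact: (markov_measurable mX).
by rewrite integral_cst//= probability_setT mule1.
Qed.

End markov_expectation.

Lemma discrete_continuous (T : choiceType) (E : topologicalType)
  (f : discrete_topology T -> E) : continuous f.
Proof. by apply/continuousP => A _; exact: discrete_open. Qed.

(** * Modes of the averaging process *)

Section averaging_modes.
Context {R : realType} {d n : nat}.
Local Notation N := n.+3.
Local Notation T := (torus d.+1 N).
Local Notation pmf := (torus_pmf R d.+1 N).
Local Notation rate := (@freq_rate R d.+1 n).
Local Notation kap := (@freq_weight R d.+1 n).
Implicit Types (x y k : T) (p : pmf) (t : R).

Lemma mass_continuous x : continuous (fun p => mass p x).
Proof.
move=> p; apply: (@continuous_comp _ _ _ (fun p : pmf => set_val p)
  (fun f : {ptws T -> R} => f x)).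
  exact: initial_continuous.
exact: (@proj_continuous _ (fun=> R) x).
Qed.

Let q k p := quad k (mass p).

Lemma quad_continuous k : continuous (q k).
Proof.
rewrite (_ : q k = fun p => \sum_(x : T) \sum_(y : T)
  mode k (y - x) * (mass p x * mass p y))//.
apply: continuous_sum => x; apply: continuous_sum => y.
by apply/continuous_scale/continuous_mul; exact: mass_continuous.
Qed.

Lemma averaging_generator_quad k : averaging_generator (q k) =
  fun p => - (2 * rate k) * q k p + \sum_j (rate k * kap * rate j) * q j p.
Proof.
apply/funext => p; have := quad_generator k (mass p).
rewrite mulrA mulr_sumr; under [in X in _ = X -> _]eq_bigr do rewrite mulrA.
by move=> <-.
Qed.

Context (S : R -> (pmf -> R) -> pmf -> R) (fS : feller_semigroup S).
Context (genS : has_generator S (@averaging_generator R d.+1 N)).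

Definition avg_mode k t : R := S t (q k) (dirac_pmf R 0).

Lemma avg_sum (a : T -> R) t : 0 <= t ->
  S t (fun p => \sum_j a j * q j p) (dirac_pmf R 0) = \sum_j a j * avg_mode j t.
Proof. by move=> t0; apply: feller_sum => // j; exact: quad_continuous. Qed.

Let cont_sum (a : T -> R) : continuous (fun p => \sum_j a j * q j p).
Proof.
by apply: continuous_sum => j; apply: continuous_scale; exact: quad_continuous.
Qed.

Lemma avg_mode0 k : avg_mode k 0 = 1.
Proof.
by rewrite /avg_mode (feller_id fS); [exact: quad_dirac|exact: quad_continuous].
Qed.

Lemma avg_mode_le1 k t : 0 <= t -> avg_mode k t <= 1.
Proof.
move=> t0; rewrite -(feller_cst fS 1 (dirac_pmf R 0) t0).
apply: (feller_le fS) => //; [exact: quad_continuous|exact: cst_continuous|].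
move=> p; have [p0 p1] : (forall x, 0 <= mass p x) /\ \sum_x mass p x = 1.
  exact: set_mem (valP p).
exact: quad_le1.
Qed.

(** The generator maps [q k] to a linear combination of the [q j], so the forward equation closes on
    the modes. *)
Lemma avg_mode_derive k : halfline_derive (avg_mode k)
  (fun t => - (2 * rate k) * avg_mode k t + rate k * flux rate kap avg_mode t).
Proof.
have cq := quad_continuous.
have cL : continuous (averaging_generator (q k)).
  by rewrite averaging_generator_quad; exact: continuousZD.
apply: halfline_derive_eq (feller_derive fS (dirac_pmf R 0) genS (cq k) cL) => //.
move=> t /ltW t0; rewrite averaging_generator_quad.
rewrite (fellerZD fS _ t0 (cq k)) ?avg_sum//; congr (_ + _).
rewrite /flux mulrA mulr_sumr; apply: eq_bigr => j _; by rewrite mulrA.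
Qed.

(** By [sum_rate_quad] the semigroup acts here on a sum of squares, and it preserves positivity. *)
Lemma flux_avg_ge0 t : 0 <= t -> 0 <= flux rate kap avg_mode t.
Proof.
move=> t0; rewrite /flux -avg_sum// mulr_ge0//.
  by rewrite ltW// freq_weight_gt0.
rewrite -[leLHS](feller_cst fS 0 (dirac_pmf R 0) t0).
apply: (feller_le fS) => //; first exact: cst_continuous.
move=> p; rewrite /q sum_rate_quad mulr_ge0 ?divr_ge0 ?exprn_ge0//.
by apply: sumr_ge0 => x _; apply: sumr_ge0 => y _; exact: sqr_ge0.
Qed.

End averaging_modes.

(** * Modes of the random walk *)

Section random_walk_modes.
Context {R : realType} {d n : nat}.
Local Notation N := n.+3.
Local Notation T := (torus d.+1 N).
Local Notation DT := (discrete_topology T).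
Local Notation rate := (@freq_rate R d.+1 n).
Implicit Types (x y k : T) (t : R).

Let dl x : DT -> R := fun z => ((z : T) == x)%:R.

Lemma lap_sym (f g : T -> R) : \sum_x f x * lap g x = \sum_x g x * lap f x.
Proof.
have := green f g; rewrite (_ : \sum_x _ = \sum_x
    \sum_(y | torus_dist x y == 1%N) (g x - g y) * (f x - f y)).
  by rewrite green => H; lra.
by apply: eq_bigr => x _; apply: eq_bigr => y _; rewrite mulrC.
Qed.

Lemma sum_delta (f : T -> R) x : \sum_y f y * dl y x = f x.
Proof.
rewrite (bigD1 x)//= /dl eqxx mulr1 big1 ?addr0// => y /negPf yx.
by rewrite eq_sym yx mulr0.
Qed.

Lemma sum_delta' (f : T -> R) x : \sum_y dl x y * f y = f x.
Proof.
rewrite -[RHS]sum_delta; apply: eq_bigr => y _.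
by rewrite mulrC /dl eq_sym.
Qed.

Context (S : R -> (DT -> R) -> DT -> R) (fS : feller_semigroup S).
Context (genS : has_generator S (@rw_generator R d.+1 N)).

(** Law of the walk read off the semigroup; [rw_form] identifies it with [law_of]. *)
Definition rw_law t x : R := S t (dl x) (0 : T).

Lemma rw_sum (f : T -> R) t : 0 <= t ->
  S t (f : DT -> R) (0 : T) = \sum_y f y * rw_law t y.
Proof.
move=> t0; rewrite -(feller_sum fS)//; last by move=> y; exact: discrete_continuous.
by congr (S t _ _); apply/funext => z; rewrite sum_delta.
Qed.

(** The derivative is the mean of [lap (dl x)] under the law; symmetry of [lap] moves the operator
    onto the law. *)
Lemma rw_law_derive x :
  halfline_derive (rw_law ^~ x) (fun t => lap (rw_law t) x).
Proof.
have cf (f : DT -> R) : continuous f := @discrete_continuous _ _ f.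
apply: halfline_derive_eq (feller_derive fS (0 : T) genS (cf (dl x)) (cf _)) => //.
move=> t /ltW t0; rewrite (@rw_sum (lap (dl x)))//.
rewrite (eq_bigr (fun y => rw_law t y * lap (dl x) y)); last by move=> y _; rewrite mulrC.
by rewrite lap_sym sum_delta'.
Qed.

Lemma quad_rw_derive k : halfline_derive (fun t => quad k (rw_law t))
  (fun t => - (2 * rate k) * quad k (rw_law t)).
Proof.
have : halfline_derive (fun t => quad k (rw_law t)) (fun t =>
    \sum_(x : T) \sum_(y : T) mode k (y - x) * (lap (rw_law t) x * rw_law t y +
      rw_law t x * lap (rw_law t) y)).
  apply: halfline_derive_sum => x _; apply: halfline_derive_sum => y _.
  by apply: halfline_deriveZ; apply: halfline_deriveM; exact: rw_law_derive.
apply: halfline_derive_eq => // t _; set p := rw_law t.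
transitivity (\sum_x lap p x * conv k p x + \sum_x lap p x * conv k p x).
  rewrite [X in _ = _ + X](_ : _ = \sum_(y : T) \sum_(x : T)
      mode k (x - y) * (p y * lap p x)); last first.
    rewrite exchange_big; apply: eq_bigr => x _; rewrite mulr_sumr.
    by apply: eq_bigr => y _; ring.
  rewrite -big_split/=; apply: eq_bigr => x _.
  rewrite mulr_sumr -big_split/=; apply: eq_bigr => y _.
  by rewrite -[mode k (x - y)]modeN opprB; ring.
rewrite (eq_bigr (fun x => conv k p x * lap p x)); last by move=> x _; rewrite mulrC.
rewrite lap_sym; under eq_bigr do rewrite lap_conv mulrCA.
by rewrite -mulr_sumr -quadE; ring.
Qed.

(** A linear equation with initial value 1: the product with the integrating factor has zero
    derivative. *)
Lemma quad_rw k t : 0 <= t -> quad k (rw_law t) = expR (- (2 * rate k) * t).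
Proof.
move=> t0.
have := halfline_deriveM (quad_rw_derive k) (halfline_derive_expR (2 * rate k)).
set f := fun t => _ * _; set f' := fun t => _ + _ => df.
have f'0 s : f' s = 0 by rewrite /f'; ring.
have fE : f t = f 0.
  apply/eqP; rewrite eq_le; apply/andP; split.
    by apply: (halfline_nonincreasing df) => // s _ _; rewrite f'0.
  by apply: (halfline_nondecreasing df) => // s _ _; rewrite f'0.
have f0 : f 0 = 1.
  rewrite /f mulr0 expR0 mulr1 -[RHS](quad_dirac k); congr (quad k _).
  apply/funext => x; rewrite /rw_law (feller_id fS); last exact: discrete_continuous.
  by rewrite /dl /dirac_mass eq_sym.
rewrite mulNr expRN -[LHS](mulfK (lt0r_neq0 (expR_gt0 (2 * rate k * t)))).
by rewrite -/(f t) fE f0 mul1r.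
Qed.

End random_walk_modes.

(** * The two Dirichlet forms as [heat] and [flux] *)

Section random_walk_law.
Context {R : realType} {d n : nat}.
Local Notation T := (torus d.+1 n.+3).

Lemma rw_form disp (Om : measurableType disp) (P : probability Om R)
    (X : R -> Om -> discrete_topology T) (t : R) :
  random_walk P (0 : T) X -> 0 <= t ->
  freq_weight d.+1 n *
    dirichlet (fun x => law_of P (X t) x / uniform_mass R x) =
  heat (@freq_rate R d.+1 n) (freq_weight d.+1 n) t.
Proof.
move=> rwX t0; have [S [fS genS ES]] := markov_expectation rwX.
have lawE : law_of P (X t) = rw_law S t.
  apply/funext => x; rewrite /law_of /rw_law; set A := [set w | _].
  have mA : measurable A.
    have op : open ([set x] : set (discrete_topology T)) by exact: discrete_open.
    exact: (process_measurable rwX t0 op).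
  pose f : discrete_topology T -> R := fun z => ((z : T) == x)%:R.
  have cf : continuous f by exact: discrete_continuous.
  have := ES t f t0 cf.
  rewrite (_ : (fun w => _) = fun w => (\1_A w)%:E).
    by rewrite integral_indic// setIT => ->.
  apply/funext => w; rewrite indicE (_ : (w \in A) = ((X t w : T) == x))//.
  by apply/idP/idP => [/set_mem h|/eqP h]; [exact/eqP|exact: mem_set].
rewrite lawE dirichlet_quad /heat; congr (_ * _).
by apply: eq_bigr => k _; rewrite (quad_rw fS genS).
Qed.

(** Packages the modes of the process with the properties that the relaxation system asks of them,
    hiding the semigroup. *)
Lemma avg_form disp (Om : measurableType disp) (P : probability Om R)
    (eta : R -> Om -> torus_pmf R d.+1 n.+3) :
  averaging_process P (dirac_pmf R (0 : T)) eta ->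
  exists y : T -> R -> R, let rate := @freq_rate R d.+1 n in
    let g := flux rate (freq_weight d.+1 n) y in
  [/\ forall k, y k 0 = 1, forall k (t : R), 0 <= t -> y k t <= 1,
      forall k, halfline_derive (y k)
        (fun t => - (2 * rate k) * y k t + rate k * g t),
      forall t : R, 0 <= t -> 0 <= g t &
      forall t : R, 0 <= t -> ('E_P[(fun w =>
          dirichlet (fun x => mass (eta t w) x / uniform_mass R x))%R] =
        ((freq_weight d.+1 n)^-1 * g t)%R%:E)%E].
Proof.
move=> avg; have [S [fS genS ES]] := markov_expectation avg.
exists (avg_mode S); split.
- exact: avg_mode0.
- by move=> k t; exact: avg_mode_le1.
- exact: avg_mode_derive.
- exact: flux_avg_ge0.
move=> t t0; rewrite unlock.
rewrite (_ : (fun w => _) = fun w => (\sum_k freq_rate k *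
    quad k (mass (eta t w)))%:E); last first.
  by apply/funext => w; rewrite dirichlet_quad.
rewrite (ES t (fun p => \sum_k freq_rate k * quad k (mass p)))//; last first.
  by apply: continuous_sum => k; apply: continuous_scale; exact: quad_continuous.
rewrite (avg_sum fS)// /flux mulKf//.
by rewrite lt0r_neq0// freq_weight_gt0.
Qed.

End random_walk_law.

(** * Constants depending only on the dimension, and the two bounds *)

Theorem theorem2p1 (R : realType) (d : nat) (hd : (1 <= d)%N) :
  exists B C1 C2 : R, [/\ 0 < B, 0 < C1, 0 < C2 &
  exists N0 : nat, forall N : nat, (1 < N)%N -> (N0 <= N)%N ->
  forall (d1 : measure_display) (Omega : measurableType d1)
    (P : probability Omega R) (eta : R -> Omega -> torus_pmf R d N),
  averaging_process P (dirac_pmf R (0 : torus d N)) eta ->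
  forall (d2 : measure_display) (Omega' : measurableType d2)
    (P' : probability Omega' R) (X : R -> Omega' -> discrete_topology (torus d N)),
  random_walk P' (0 : torus d N) X ->
  forall t : R, 0 <= t ->
  let pi_t := law_of P' (X t) in
  let form_rw := dirichlet (fun x => pi_t x / uniform_mass R x) in
  let form_avg := fun w => dirichlet (fun x => mass (eta t w) x / uniform_mass R x) in
  (((1 + C1 * Num.min t 1) * form_rw)%:E <= 'E_P[form_avg] /\
   'E_P[form_avg] <= (C2 * expR (B * t / N%:R ^+ (d + 2)) * form_rw)%:E)%E].
Proof.
case: d hd => // d _.
pose D : R := theta'_const * 16 ^+ d.+1.-1.
pose A : R := diffusive_const d.+1.
pose C : R := A * d.+1%:R.
pose Lam : R := 2 * d.+1%:R.
have A0 : 0 < A by rewrite !mulr_gt0 ?exprn_gt0 ?expR_gt0.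
have C0 : 0 < C by rewrite mulr_gt0 ?ltr0n.
have D0 : 0 < D by rewrite !mulr_gt0 ?exprn_gt0 ?expR_gt0.
have Lam0 : 0 < Lam by rewrite mulr_gt0 ?ltr0n.
have [j hj] : exists j : nat, 8 * Num.max D (C * expR 32) <= 2 ^+ j :> R.
  set m := 8 * _; exists (Num.bound m); apply: le_trans (ltW (archi_boundP _)) _.
    by rewrite mulr_ge0// le_max ltW.
  by rewrite -natrX ler_nat ltnW// ltn_expl.
pose E : R := D ^+ j.+1 * 2 ^+ j.
pose F : R := E * C * expR 32.
have E0 : 0 < E by rewrite /E mulr_gt0 ?exprn_gt0.
have F0 : 0 < F := mulr_gt0 (mulr_gt0 E0 C0) (expR_gt0 32).
(* The first witness is the condition on [b] in [flux_upper_explicit] once the gap is bounded by 32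
   / N^2; the other two are the constants of [flux_lower] and [flux_upper_explicit], with [Lam]
   twice the dimension. *)
exists (8 * F * (A * 32)), (1 + 2 * Lam)^-1,
  (expR (2 * Lam) + 4 * (1 + F * expR 32 + E)); split.
- by apply: mulr_gt0; lra.
- by rewrite invr_gt0; lra.
- by have := expR_gt0 (2 * Lam); have := mulr_gt0 F0 (expR_gt0 32); lra.
(* From N = 3 on, the two neighbors of a site in each direction are distinct. *)
exists 3%N; case=> [|[|[|n]]]// _ _ d1 Om P eta avg d2 Om' P' X rwX t t0.
move=> pi_t form_rw form_avg.
have [y [y0 y1 dy g0 EE]] := avg_form avg.
have K0 : 0 < freq_weight d.+1 n :> R by exact: freq_weight_gt0.
have NN : 1 <= n.+3%:R ^+ 2 :> R by rewrite exprn_ege1// ler1n.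
have form_rwE : form_rw = (freq_weight d.+1 n)^-1 *
    heat (@freq_rate R d.+1 n) (freq_weight d.+1 n) t.
  by rewrite -(rw_form rwX t0) mulKf// lt0r_neq0.
rewrite /form_avg (EE t t0) !lee_fin form_rwE; split.
  rewrite [leLHS]mulrCA ler_pM2l ?invr_gt0//.
  apply: flux_lower => //; [exact: freq_rate_ge0|exact: freq_rate_le|
    exact: freq_weight_sum|exact: freq_weight_card].
rewrite [leRHS]mulrCA ler_pM2l ?invr_gt0// (_ : 8 * F * (A * 32) * t / _ =
  8 * F * (A * 32) / n.+3%:R ^+ (d.+1 + 2) * t); last by ring.
have rate_ge0 := @freq_rate_ge0 R d.+1 n.
have d0 : (0 < d.+1)%N by [].
pose b : R := 8 * F * (A * 32) / n.+3%:R ^+ (d.+1 + 2).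
have b0 : 0 < b by rewrite divr_gt0 ?exprn_gt0 ?ltr0n//; apply: mulr_gt0; lra.
have Ab : 8 * F * (A * rate_nat n 1 / n.+3%:R ^+ d.+1) <= b.
  have FA0 : 0 <= 8 * F * A by apply: mulr_ge0; lra.
  have := ler_wpM2l FA0 (@gap_scale R d.+1 n).
  by rewrite /b !mulrA.
exact: (flux_upper_explicit rate_ge0 (@freq_rate_le R d.+1 n) K0
  (@freq_weight_sum R d.+1 n d0) (@freq_weight_card R d.+1 n d0) y0 y1 dy g0 NN C0
  (ltW (gap_gt0 n)) (gap_le n) (@freq_gap R d.+1 n) (torus_heat_half d0)
  (torus_heat_le d0) (fun t _ => @torus_heat_ge R d.+1 n d0 t) hj b0 Ab t0).
Qed.
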